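(* The autocovariance function $\gamma_{MA}(n)$, for $n=1,\dots,p-1$, of the filtered sampled process $(\phi(B)Y_j^\Delta)_{j\in\mathbb{Z}}$ has for $\Delta\downarrow0$ the asymptotic form $$\gamma_{MA}(n)\sim\frac{\sigma^2\Delta^{2(p-q)-1}}{((p-q-1)!)^2}\sum_{i=1}^{p-n}\sum_{k=0}^{n+i-1}\sum_{h=0}^{i-1}(-1)^{h+k}\binom pk\binom ph\,C(h,k,i,n;p-q-1),$$ where for $N\in\mathbb{N}_0$ $$C(h,k,i,n;N):=\int_0^1(s+i-1-h)^N(s+i-1-k+n)^N\,ds.$$
   Context: Let $L=(L_t)_{t\in\mathbb{R}}$ be a (two-sided, real-valued) second-order Lévy process with $E L_1=0$ and $E L_1^2=\sigma^2$. Let $p,q$ be integers with $0\le q<p$, and let $a(z)=z^p+a_1z^{p-1}+\cdots+a_p$ and $b(z)=b_0+b_1z+\cdots+b_{p-1}z^{p-1}$ be real polynomials with $b_q=1$ and $b_j=0$ for $q<j<p$. Assume $a$ and $b$ have no common zeroes and all zeroes of $a$ have strictly negative real part. Denote the zeroes of $a$, repeated according to multiplicity, by $\lambda_1,\dots,\lambda_p$. The CARMA$(p,q)$ process $Y=(Y_t)_{t\in\mathbb{R}}$ is the strictly stationary process $$Y_t=\int_{-\infty}^\infty g(t-u)\,dL_u,\qquad g(t)=\sum_{\lambda}\mathrm{Res}_{z=\lambda}\Big(e^{zt}\frac{b(z)}{a(z)}\Big)\ (t>0),\quad g(t)=0\ (t\le 0),$$ the sum being over the distinct zeroes $\lambda$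 of $a$. Equivalently, $g(t)=\mathbf b^\top e^{At}\mathbf e_p\mathbf 1_{(0,\infty)}(t)$, where $A$ is the companion matrix of $a$ (ones on the superdiagonal, last row $(-a_p,\dots,-a_1)$), $\mathbf b=(b_0,\dots,b_{p-1})^\top$, $\mathbf e_p=(0,\dots,0,1)^\top$. For $\Delta>0$ the sampled process is $Y^\Delta=(Y_{n\Delta})_{n\in\mathbb{Z}}$, $Y^\Delta_n=Y_{n\Delta}$; $B$ is the backward shift ($BY^\Delta_n=Y^\Delta_{n-1}$), and $\phi(B)=\prod_{j=1}^p(1-e^{\lambda_j\Delta}B)$. The process $(\phi(B)Y_j^\Delta)_{j\in\mathbb{Z}}$ is strictly stationary, and $\gamma_{MA}(n)$ denotes its autocovariance at lag $n$ (it depends on $\Delta$). The notation $u(\Delta)\sim v(\Delta)$ means $\lim_{\Delta\downarrow0}u(\Delta)/v(\Delta)=1$.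
   Formalization: The relation ~ is asserted only when its right-hand side is not identically zero (it is zero for σ=0, and also for p=4, q=2, n=2); with no restriction it is proved that γ_MA(n)/Δ^{2(p−q)−1} tends to the stated constant. *)

(* Defs.v *)
(* MathComp / MathComp-Analysis, with R[i] from mathcomp-real-closed. *)
From HB Require Import structures.
From mathcomp Require Import all_boot all_order all_algebra.
From mathcomp Require Import all_classical all_reals all_analysis.
From mathcomp Require Import complex.
Set Implicit Arguments.
Unset Strict Implicit.
Unset Printing Implicit Defensive.
Import Order.TTheory GRing.Theory Num.Theory.
Import numFieldNormedType.Exports.
Local Open Scope classical_set_scope.
Local Open Scope ring_scope.

Section Levy.
Context (R : realType) (d : measure_display) (T : measurableType d).
Context (P : probability T R).

(* Subfamilies are covered by taking B i = setT. *)
Definition mutually_independent (m : nat) (X : 'I_m -> T -> R) : Prop :=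
  forall B : 'I_m -> set R, (forall i, measurable (B i)) ->
    P (\bigcap_(i in [set: 'I_m]) X i @^-1` B i) =
    (\prod_(i < m) P (X i @^-1` B i))%E.

Definition independent_increments (L : R -> T -> R) : Prop :=
  forall (m : nat) (t : nat -> R), nondecreasing_seq t ->
    mutually_independent (fun i : 'I_m => L (t i.+1) \- L (t i)).

Definition stationary_increments (L : R -> T -> R) : Prop :=
  forall (s t h : R) (B : set R), s <= t -> measurable B ->
    P ((L (t + h) \- L (s + h)) @^-1` B) = P ((L t \- L s) @^-1` B).

Definition continuous_in_probability (L : R -> T -> R) : Prop :=
  forall (t e : R), 0 < e ->
    P [set w | e <= `|L s w - L t w|] @[s --> t] --> 0%E.

Definition cadlag (x : R -> R) : Prop :=
  forall t : R, x s @[s --> t^'+] --> x t /\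
                exists l : R, x s @[s --> t^'-] --> l.

Definition levy_process (L : R -> {RV P >-> R}) : Prop :=
  [/\ {ae P, forall w, L 0 w = 0},
      independent_increments (fun t => L t),
      stationary_increments (fun t => L t),
      continuous_in_probability (fun t => L t) &
      {ae P, forall w, cadlag (fun t => L t w)}].

Definition second_order (L : R -> {RV P >-> R}) : Prop :=
  forall t : R, (L t : T -> R) \in Lfun P 2%:E.

(* The entry (c, (s, t)), with s <= t, stands for c 1_(s,t]. *)
Definition step_wf (h : seq (R * (R * R))) : bool :=
  all (fun x => x.2.1 <= x.2.2) h.

Definition step_fun (h : seq (R * (R * R))) (u : R) : R :=
  \sum_(x <- h) x.1 * \1_(`]x.2.1, x.2.2]) u.

Definition step_integral (L : R -> T -> R) (h : seq (R * (R * R))) (w : T)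
    : R :=
  \sum_(x <- h) x.1 * (L x.2.2 w - L x.2.1 w).

(* X is a version of the integral of the deterministic function f over the
   whole line: the L^2(P)-limit of the integrals of step functions which
   converge to f in L^2(R). *)
Definition is_stochastic_integral (L : R -> T -> R) (f : R -> R)
    (X : T -> R) : Prop :=
  exists h : nat -> seq (R * (R * R)),
    [/\ forall m, step_wf (h m),
        (\int[@lebesgue_measure R]_u ((step_fun (h m) u - f u) ^+ 2)%:E)%E
          @[m --> \oo] --> 0%E &
        (\int[P]_w ((step_integral L (h m) w - X w) ^+ 2)%:E)%E
          @[m --> \oo] --> 0%E].

End Levy.

Section Carma.
Context (R : realType).

Definition expmx (m : nat) (A : 'M[R]_m) : 'M[R]_m :=
  \matrix_(i, j) limn (series (fun k => (A ^+ k) i j / k`!%:R)).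

(* For a monic of degree p, companionmx a is p x p, with ones on the
   superdiagonal and last row (-a_p, ..., -a_1) (a`_j is a_(p-j)). *)
Definition carma_kernel (a b : {poly R}) (t : R) : R :=
  let p := (size a).-1 in
  let bT : 'rV[R]_p := \row_j b`_j in
  let ep : 'cV[R]_p := \col_i (i.+1 == p)%:R in
  if 0 < t then (bT *m expmx (t *: companionmx a) *m ep) 0 0 else 0.

Definition is_carma (d : measure_display) (T : measurableType d)
    (P : probability T R) (L : R -> {RV P >-> R}) (a b : {poly R})
    (Y : R -> {RV P >-> R}) : Prop :=
  forall t : R,
    is_stochastic_integral P (fun u => L u)
      (fun u => carma_kernel a b (t - u)) (Y t).

Definition polyC_of (a : {poly R}) : {poly R[i]} :=
  map_poly (real_complex R) a.

Definition expC (z : R[i]) : R[i] :=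
  (expR (complex.Re z) * cos (complex.Im z)
   +i* (expR (complex.Re z) * sin (complex.Im z)))%C.

Definition ar_poly (p : nat) (lambda : 'I_p -> R[i]) (D : R) : {poly R[i]} :=
  \prod_(j < p) (1 - expC (lambda j * D%:C%C) *: 'X).

Section Sampled.
Context (T : Type).

Definition sampled (Y : R -> T -> R) (D : R) : int -> T -> R :=
  fun n => Y (n%:~R * D).

Definition backshift (X : int -> T -> R) : int -> T -> R := fun n => X (n - 1).

(* phi(B) X. The real part loses nothing for phi = ar_poly lambda D: when the
   lambda j are the roots of a real polynomial, the coefficients of phi are
   real, as the lambda j come in conjugate pairs. *)
Definition filtered (phi : {poly R[i]}) (X : int -> T -> R) : int -> T -> R :=
  fun n w => \sum_(k < size phi) complex.Re phi`_k * iter k backshift X n w.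

End Sampled.

(* Autocovariance at lag n of a stationary sequence, read off at times n and
   0. *)
Definition autocovariance (d : measure_display) (T : measurableType d)
    (P : probability T R) (X : int -> T -> R) (n : nat) : R :=
  fine (covariance P (X n%:Z) (X 0)).

Definition gammaMA (d : measure_display) (T : measurableType d)
    (P : probability T R) (Y : R -> T -> R) (p : nat) (lambda : 'I_p -> R[i])
    (n : nat) (D : R) : R :=
  autocovariance P (filtered (ar_poly lambda D) (sampled Y D)) n.

Definition Ccoef (h k i n N : nat) : R :=
  \int[@lebesgue_measure R]_(s in `[0, 1])
    ((s + i%:R - 1 - h%:R) ^+ N * (s + i%:R - 1 - k%:R + n%:R) ^+ N).

Definition Csum (p q n : nat) : R :=
  \sum_(1 <= i < (p - n).+1) \sum_(0 <= k < n + i) \sum_(0 <= h < i)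
    (-1) ^+ (h + k) * 'C(p, k)%:R * 'C(p, h)%:R * Ccoef h k i n (p - q - 1).

(* u(D) ~ v(D) as D decreases to 0. *)
Definition asymp_equiv (u v : R -> R) : Prop :=
  u D / v D @[D --> 0^'+] --> (1 : R).

End Carma.

(* Main.v *)
Require Import Defs.
From HB Require Import structures.
From mathcomp Require Import all_boot all_order all_algebra.
From mathcomp Require Import all_classical all_reals all_analysis.
From mathcomp Require Import complex.
From mathcomp Require Import measurable_realfun.
From mathcomp Require Import ring lra zify.
Import Order.TTheory GRing.Theory Num.Theory.
Import numFieldNormedType.Exports.
Local Open Scope classical_set_scope.
Local Open Scope ring_scope.

(** Write N = p - q - 1, let c_k(D) be the coefficients of phi(B), let g be the
    CARMA kernel and K the entire function that coincides with g on the positive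
    half-line.

    The increments of L are centered, and their variance is sigma^2 times their
    length: variances add up over disjoint intervals by independence, so they
    are linear by nonnegativity, while the mean is additive, bounded near 0 by
    continuity in probability, and zero for length 1
    (levy_increment_mean, levy_increment_sqr). By polarization the integral of
    step functions is sigma times an isometry, and this passes to limits in
    mean square (stochastic_integral_isometry). Hence gamma_MA(n) is sigma^2
    times the inner product in L^2(R) of F_n and F_0, where
    F_m(u) = sum_k c_k(D) g((m - k) D - u) (gammaMA_inner).

    K is annihilated by the product of the d/dt - lambda_j, by the
    Cayley-Hamilton theorem for the companion matrix, and therefore by phi(B):
    each root is removed by observing that w' = l w implies
    w(t) = e^(l D) w(t - D) (lagop_cegf_eq0, carma_lag_eq0). So F_m lives on the
    interval from (m - p) D to m D, and F_n F_0 on p - n cells of length D. On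
    each cell it is a combination of products of two values of K, and after
    rescaling the cell to [0, 1] one finds (inner_sampled_kernel)

      gamma_MA(n) = sigma^2 D sum_(i, k, h) c_k(D) c_h(D)
        int_0^1 K((s + i - h) D) K((s + n + i - k) D) ds

    with i < p - n, k <= n + i and h <= i.

    It remains to let D tend to 0. The first N derivatives of K at 0, counted
    from order 0, vanish and the next one is 1, so that K(t) = t^N rho(t) with
    rho continuous and rho(0) = 1 / N! (carma_moment_lt, carma_moment_eq,
    egf_factor). This extracts the power D^(2 N) from the integrals. As phi(B)
    tends to (1 - B)^p, the coefficient c_k(D) tends to (-1)^k binom(p, k)
    (cvg_lag_prod_coef), and the integrals converge by dominated convergence
    (cvg_small_step_integral). *)

Set Implicit Arguments.
Unset Strict Implicit.
Unset Printing Implicit Defensive.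

(** * The inner product of square-integrable functions *)

Section L2.
Context d (T : measurableType d) (R : realType).
Variable mu : {measure set T -> \bar R}.
Implicit Types f g h : T -> R.

Lemma Lfun2_measurable f : f \in Lfun mu 2%:E -> measurable_fun setT f.
Proof. by rewrite inE => /andP[/[!inE]]. Qed.

Lemma measurable_Lfun2 f : measurable_fun setT f ->
  (\int[mu]_x ((f x) ^+ 2)%:E < +oo)%E -> f \in Lfun mu 2%:E.
Proof.
move=> mf fy; rewrite inE; apply/andP; split; rewrite inE//=.
rewrite /finite_norm unlock; apply: poweR_lty.
by under eq_integral do rewrite poweR_EFin powR_mulrn// real_normK ?num_real//.
Qed.

Lemma Lfun2D f g : f \in Lfun mu 2%:E -> g \in Lfun mu 2%:E ->
  (fun x => f x + g x) \in Lfun mu 2%:E.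
Proof.
by move=> ff fg; rewrite (_ : (fun _ => _) = f + g)// rpredD// lee1n.
Qed.

Lemma Lfun2Z c f : f \in Lfun mu 2%:E -> (fun x => c * f x) \in Lfun mu 2%:E.
Proof.
by move=> ff; rewrite (_ : (fun _ => _) = c \o* f) ?Lfun_scale ?ler1n//;
  apply/funext => x /=; rewrite mulrC.
Qed.

Lemma Lfun2B f g : f \in Lfun mu 2%:E -> g \in Lfun mu 2%:E ->
  (fun x => f x - g x) \in Lfun mu 2%:E.
Proof.
by move=> ff fg; rewrite (_ : (fun _ => _) = f - g)// rpredB// lee1n.
Qed.

Lemma Lfun2_sum (I : eqType) (s : seq I) (c : I -> R) (F : I -> T -> R) :
  {in s, forall i, F i \in Lfun mu 2%:E} ->
  (fun x => \sum_(i <- s) c i * F i x) \in Lfun mu 2%:E.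
Proof.
elim: s => [|i s IH] sF.
  rewrite (_ : (fun _ => _) = (0 : T -> R)) ?rpred0 ?lee1n//.
  by apply/funext => x; rewrite big_nil.
rewrite (_ : (fun _ => _) =
    (fun x => c i * F i x + \sum_(j <- s) c j * F j x)); last first.
  by apply/funext => x; rewrite big_cons.
apply: Lfun2D; first by apply: Lfun2Z; apply: sF; rewrite mem_head.
by apply: IH => j js; apply: sF; rewrite inE js orbT.
Qed.

Definition inner f g : R := (\int[mu]_x (f x * g x)).

Lemma innerC f g : inner f g = inner g f.
Proof. by apply: eq_Rintegral => x _; rewrite mulrC. Qed.

Lemma Lfun2_mul_integrable f g : f \in Lfun mu 2%:E -> g \in Lfun mu 2%:E ->
  mu.-integrable setT (EFin \o (fun x => f x * g x)).
Proof. by move=> ff fg; apply/Lfun1_integrable; apply: Lfun2_mul_Lfun1. Qed.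

Lemma innerD f g h : f \in Lfun mu 2%:E -> g \in Lfun mu 2%:E ->
  h \in Lfun mu 2%:E ->
  inner (fun x => f x + g x) h = inner f h + inner g h.
Proof.
move=> ff fg fh; rewrite -RintegralD//; try exact: Lfun2_mul_integrable.
by apply: eq_Rintegral => x _; rewrite mulrDl.
Qed.

Lemma innerZ c f h : f \in Lfun mu 2%:E -> h \in Lfun mu 2%:E ->
  inner (fun x => c * f x) h = c * inner f h.
Proof.
move=> ff fh; rewrite -RintegralZl//; last exact: Lfun2_mul_integrable.
by apply: eq_Rintegral => x _; rewrite mulrA.
Qed.

Lemma innerB f g h : f \in Lfun mu 2%:E -> g \in Lfun mu 2%:E ->
  h \in Lfun mu 2%:E ->
  inner (fun x => f x - g x) h = inner f h - inner g h.
Proof.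
move=> ff fg fh; rewrite -RintegralB//; try exact: Lfun2_mul_integrable.
by apply: eq_Rintegral => x _; rewrite mulrBl.
Qed.

Lemma inner_sum (I : eqType) (s : seq I) (c : I -> R) (F : I -> T -> R) h :
  {in s, forall i, F i \in Lfun mu 2%:E} -> h \in Lfun mu 2%:E ->
  inner (fun x => \sum_(i <- s) c i * F i x) h =
  \sum_(i <- s) c i * inner (F i) h.
Proof.
move=> + fh; elim: s => [|i s IH] sF.
  rewrite big_nil /inner; under eq_Rintegral do rewrite big_nil mul0r.
  by rewrite Rintegral_cst// mul0r.
rewrite big_cons -IH; last by move=> j js; apply: sF; rewrite inE js orbT.
have fi : F i \in Lfun mu 2%:E by apply: sF; rewrite mem_head.
rewrite -innerZ// -innerD//.
- by congr (inner _ h); apply/funext => x; rewrite big_cons.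
- exact: Lfun2Z.
- by apply: Lfun2_sum => j js; apply: sF; rewrite inE js orbT.
Qed.

Lemma inner_ge0 f : 0 <= inner f f.
Proof. by apply: Rintegral_ge0 => x _; rewrite -expr2 sqr_ge0. Qed.

Lemma integral_sqr_inner f : f \in Lfun mu 2%:E ->
  (\int[mu]_x ((f x) ^+ 2)%:E)%E = (inner f f)%:E.
Proof.
move=> ff; rewrite /inner /Rintegral fineK.
  by apply: eq_integral => x _; rewrite expr2.
exact/integrable_fin_num/Lfun2_mul_integrable.
Qed.

Lemma inner_sqrD f g : f \in Lfun mu 2%:E -> g \in Lfun mu 2%:E ->
  inner (fun x => f x + g x) (fun x => f x + g x) =
  inner f f + inner f g *+ 2 + inner g g.
Proof.
move=> ff fg; have fD := Lfun2D ff fg.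
rewrite innerD// (innerC f) (innerC g) !innerD// (innerC g f).
by rewrite mulr2n !addrA.
Qed.

(** Cauchy-Schwarz, from the discriminant of the nonnegative quadratic
    polynomial t |-> |t f + g|^2. *)
Lemma inner_le f g : f \in Lfun mu 2%:E -> g \in Lfun mu 2%:E ->
  inner f g ^+ 2 <= inner f f * inner g g.
Proof.
move=> ff fg.
have q t : 0 <= t ^+ 2 * inner f f + t * inner f g *+ 2 + inner g g.
  have := inner_ge0 (fun x => t * f x + g x).
  have ftg : (fun x => t * f x) \in Lfun mu 2%:E by exact: Lfun2Z.
  rewrite inner_sqrD// (innerZ t ff ftg) (innerC f) !(innerZ t ff)//.
  congr (_ <= _); ring.
have [f0|f0] := eqVneq (inner f f) 0.
  have [fg0|fg0] := eqVneq (inner f g) 0; first by rewrite f0 fg0; lra.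
  (* at this point the polynomial, now affine, takes the value -1 *)
  have := q (- (inner g g + 1) / (inner f g *+ 2)).
  rewrite f0 mulr0 add0r.
  rewrite -mulrnAr mulrAC -mulrA divff ?mulrn_eq0//=; lra.
have f1 : 0 < inner f f by rewrite lt_neqAle eq_sym f0 inner_ge0.
have := q (- inner f g / inner f f).
have -> : (- inner f g / inner f f) ^+ 2 * inner f f +
    - inner f g / inner f f * inner f g *+ 2 + inner g g =
    (inner f f * inner g g - inner f g ^+ 2) / inner f f.
  by field.
by rewrite pmulr_lge0 ?invr_gt0// subr_ge0.
Qed.

Lemma normr_inner_le f g : f \in Lfun mu 2%:E -> g \in Lfun mu 2%:E ->
  `|inner f g| <= Num.sqrt (inner f f) * Num.sqrt (inner g g).
Proof.
move=> ff fg; rewrite -sqrtrM ?inner_ge0// -sqrtr_sqr ler_wsqrtr//.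
exact: inner_le.
Qed.

(** Cauchy-Schwarz applies to each term of an expansion of the difference. *)
Lemma cvg_inner (f_ g_ : nat -> T -> R) f g :
  (forall n, f_ n \in Lfun mu 2%:E) -> (forall n, g_ n \in Lfun mu 2%:E) ->
  f \in Lfun mu 2%:E -> g \in Lfun mu 2%:E ->
  inner (fun x => f_ n x - f x) (fun x => f_ n x - f x)
    @[n --> \oo] --> (0 : R) ->
  inner (fun x => g_ n x - g x) (fun x => g_ n x - g x)
    @[n --> \oo] --> (0 : R) ->
  inner (f_ n) (g_ n) @[n --> \oo] --> inner f g.
Proof.
move=> lf_ lg_ lf lg cf cg.
set a := fun n => inner (fun x => f_ n x - f x) _ in cf.
set b := fun n => inner (fun x => g_ n x - g x) _ in cg.
have ca : Num.sqrt (a n) @[n --> \oo] --> (0 : R).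
  rewrite -[X in _ --> X]sqrtr0; apply: continuous_cvg => //.
  exact: sqrt_continuous.
have cb : Num.sqrt (b n) @[n --> \oo] --> (0 : R).
  rewrite -[X in _ --> X]sqrtr0; apply: continuous_cvg => //.
  exact: sqrt_continuous.
apply/(@subr_cvg0 _ R^o)/(@norm_cvg0P _ R^o).
(* <f_n, g_n> - <f, g> = <f_n - f, g_n - g> + <f_n - f, g> + <f, g_n - g> *)
pose e n := Num.sqrt (a n) * Num.sqrt (b n) +
  (Num.sqrt (a n) * Num.sqrt (inner g g) +
   Num.sqrt (inner f f) * Num.sqrt (b n)).
apply: (@squeeze_cvgr _ _ _ _ (fun=> 0) e).
- near=> n; rewrite normr_ge0/=.
  have df : (fun x => f_ n x - f x) \in Lfun mu 2%:E by exact: Lfun2B.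
  have dg : (fun x => g_ n x - g x) \in Lfun mu 2%:E by exact: Lfun2B.
  have -> : inner (f_ n) (g_ n) - inner f g =
     inner (fun x => f_ n x - f x) (fun x => g_ n x - g x) +
     (inner (fun x => f_ n x - f x) g + inner f (fun x => g_ n x - g x)).
    rewrite innerB// (innerC (f_ n) (fun x => _ - _)).
    rewrite (innerC f (fun x => _ - _)).
    by rewrite !innerB// (innerC g) (innerC (g_ n)) (innerC g); ring.
  apply: (le_trans (ler_normD _ _)); apply: lerD.
    exact: normr_inner_le.
  by apply: (le_trans (ler_normD _ _)); apply: lerD; exact: normr_inner_le.
- exact: cvg_cst.
- rewrite (_ : 0 = 0 * 0 +
    (0 * Num.sqrt (inner g g) + Num.sqrt (inner f f) * 0)); last by ring.
  by apply: cvgD; [exact: cvgM|apply: cvgD; apply: cvgM => //; exact: cvg_cst].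
Unshelve. all: by end_near. Qed.

(** The limit is square-integrable, because it is at a finite distance from
    one of the f_ n. *)
Lemma cvg_sqr_integral (f_ : nat -> T -> R) f :
  (forall n, f_ n \in Lfun mu 2%:E) -> measurable_fun setT f ->
  (\int[mu]_x ((f_ n x - f x) ^+ 2)%:E)%E @[n --> \oo] --> 0%E ->
  f \in Lfun mu 2%:E /\
  inner (fun x => f_ n x - f x) (fun x => f_ n x - f x)
    @[n --> \oo] --> (0 : R).
Proof.
move=> lf_ mf /fine_cvgP[fin cvg0].
have mB n : measurable_fun setT (fun x => f_ n x - f x).
  by apply: measurable_funB => //; exact: Lfun2_measurable.
have lf : f \in Lfun mu 2%:E.
  have [n _ /(_ n (leqnn n)) /= finn] := fin.
  have : (fun x => f_ n x - f x) \in Lfun mu 2%:E.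
    by apply: (measurable_Lfun2 (mB n)); rewrite ltey_eq finn.
  move=> /(Lfun2B (lf_ n)).
  rewrite (_ : (fun _ => _) = f)//.
  by apply/funext => x; rewrite opprB addrC subrK.
by split.
Qed.

End L2.

(** * Products of independent variables *)

Section independent_product.
Context d (T : measurableType d) (R : realType) (P : probability T R).

(** The joint law of independent variables is the product of their laws, so
    the claim is Fubini's theorem for the function (x, y) |-> x y. *)
Lemma Rintegral_mul_independent (X Y : {RV P >-> R}) :
  (X : T -> R) \in Lfun P 2%:E -> (Y : T -> R) \in Lfun P 2%:E ->
  (forall A B : set R, measurable A -> measurable B ->
    P (X @^-1` A `&` Y @^-1` B) = (P (X @^-1` A) * P (Y @^-1` B))%E) ->
  \int[P]_w (X w * Y w) = (\int[P]_w X w) * (\int[P]_w Y w).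
Proof.
move=> X2 Y2 XY.
have PT : P setT \is a fin_num by rewrite probability_setT.
have X1 := Lfun_subset12 PT X2; have Y1 := Lfun_subset12 PT Y2.
have /Lfun1_integrable iX := X1; have /Lfun1_integrable iY := Y1.
pose Z := (fun w => (X w, Y w)) : T -> R * R.
have mZ : measurable_fun setT Z by apply: measurable_fun_pair.
pose f := fun z : R * R => (z.1 * z.2)%:E.
have mf : measurable_fun setT f.
  by apply/measurable_EFinP; apply: measurable_funM.
have ifZ : P.-integrable setT (f \o Z) by exact: Lfun2_mul_integrable.
have EXY : (\int[P]_w (X w * Y w)%:E = \int[pushforward P Z]_z f z)%E.
  by rewrite integral_pushforward.
have prodE : forall C, measurable C ->
    (distribution P X \x distribution P Y)%E C = pushforward P Z C.
  apply: product_measure_unique => A B mA mB.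
  by rewrite -[RHS]XY.
have ifp : (distribution P X \x distribution P Y)%E.-integrable setT f.
  have /integrableP[_ h] := integrable_pushforward mZ mf ifZ measurableT.
  apply/integrableP; split => //.
  rewrite (eq_measure_integral (pushforward P Z))// => A mA _; exact: prodE.
have EfP : (\int[pushforward P Z]_z f z =
    \int[distribution P X \x distribution P Y]_z f z)%E.
  by apply: eq_measure_integral => A mA _; rewrite [RHS]prodE.
rewrite {1}/Rintegral EXY EfP -integral12_prod_meas1// /f/=.
have EX : (\int[P]_w (X w)%:E = \int[distribution P X]_x x%:E)%E.
  by rewrite [RHS]integral_distribution.
have EY : (\int[P]_w (Y w)%:E = \int[distribution P Y]_y y%:E)%E.
  by rewrite [RHS]integral_distribution.
have finX : (\int[distribution P X]_x x%:E \is a fin_num)%E.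
  by rewrite -EX; exact: integrable_fin_num.
have finY : (\int[distribution P Y]_y y%:E \is a fin_num)%E.
  by rewrite -EY; exact: integrable_fin_num.
have iidX : (distribution P X).-integrable setT EFin.
  by apply: integrable_pushforward.
have iidY : (distribution P Y).-integrable setT EFin.
  by apply: integrable_pushforward.
rewrite /Rintegral EX EY -fineM//; congr fine.
transitivity
  (\int[distribution P X]_x (x%:E * \int[distribution P Y]_y y%:E))%E.
  by apply: eq_integral => x _ /=; rewrite -integralZl//; apply: eq_integral.
by rewrite -[in LHS](fineK finY) integralZr// fineK.
Qed.
End independent_product.

(** * Additive functions on the half-line *)

Section additive.
Variable R : realType.

Lemma mulrn_bounded_le0 (x c : R) : (forall n, x *+ n <= c) -> x <= 0.
Proof.
move=> xc; rewrite leNgt; apply/negP => x0.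
have := xc (Num.Def.truncn (c / x)).+1.
rewrite leNgt => /negP; apply.
rewrite -mulr_natl -ltr_pdivrMr//.
exact: truncnS_gt.
Qed.

(** An additive function that is bounded near 0 and vanishes at 1 is bounded
    altogether, since 1 / K is a period of it for all K; and a bounded additive
    function vanishes, because its value at n t is n times its value at t. *)
Lemma additive_bounded_eq0 (f : R -> R) (c delta : R) :
  (forall s t, 0 <= s -> 0 <= t -> f (s + t) = f s + f t) -> f 1 = 0 ->
  0 < delta -> (forall t, 0 <= t < delta -> `|f t| <= c) ->
  forall t, 0 <= t -> f t = 0.
Proof.
move=> fD f1 d0 fc.
have f0 : f 0 = 0 by have := fD 0 0 (lexx _) (lexx _); rewrite addr0; lra.
have fn n t : 0 <= t -> f (t *+ n) = f t *+ n.
  move=> t0; elim: n => [|n IH]; first by rewrite !mulr0n.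
  by rewrite !mulrS fD// ?IH// mulrn_wge0.
pose K := (Num.Def.truncn delta^-1).+1.
have K0 : (0 : R) < K%:R by rewrite ltr0n.
have Kd : K%:R^-1 < delta.
  by rewrite invf_plt ?posrE//; exact: truncnS_gt.
have fK : f K%:R^-1 = 0.
  have := fn K K%:R^-1; rewrite invr_ge0 ltW// => /(_ isT).
  have -> : K%:R^-1 *+ K = 1 :> R by rewrite -[LHS]mulr_natl divff ?gt_eqF.
  by rewrite f1 => /esym/eqP; rewrite mulrn_eq0/= => /eqP.
have fb t : 0 <= t -> `|f t| <= c.
  move=> t0; pose k := Num.Def.truncn (t * K%:R).
  have tK0 : 0 <= t * K%:R by rewrite mulr_ge0// ltW.
  have /andP[kt tk] : k%:R <= t * K%:R < k.+1%:R by exact: truncn_itv.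
  have tE : t = K%:R^-1 *+ k + (t - K%:R^-1 *+ k) by rewrite addrC subrK.
  have kE : K%:R^-1 *+ k = k%:R / K%:R :> R by rewrite -[LHS]mulr_natl.
  have r0 : 0 <= t - K%:R^-1 *+ k by rewrite kE subr_ge0 ler_pdivrMr.
  rewrite tE fD// ?mulrn_wge0 ?invr_ge0 ?(ltW K0)// fn ?invr_ge0 ?(ltW K0)//.
  rewrite fK mul0rn add0r fc// r0/= (le_lt_trans _ Kd)//.
  by rewrite kE lerBlDr -[X in X + _]div1r -mulrDl ler_pdivlMr// nat1r ltW.
move=> t t0; apply/eqP; rewrite -normr_le0; apply: (@mulrn_bounded_le0 _ c) => n.
by rewrite -normrMn -fn// fb// mulrn_wge0.
Qed.

(** By monotonicity, f and its linear interpolation from 0 to 1 differ by at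
    most f 1 on [0, 1]; their difference is additive and vanishes at 1. *)
Lemma additive_ge0_linear (f : R -> R) :
  (forall s t, 0 <= s -> 0 <= t -> f (s + t) = f s + f t) ->
  (forall t, 0 <= t -> 0 <= f t) -> forall t, 0 <= t -> f t = t * f 1.
Proof.
move=> fD f0 t t0; apply/eqP; rewrite -subr_eq0; apply/eqP.
apply: (@additive_bounded_eq0 (fun t => f t - t * f 1) (f 1) 1) => //.
- by move=> u v u0 v0; rewrite fD//; ring.
- by rewrite mul1r subrr.
- move=> u /andP[u0 u1].
  have fu0 := f0 _ u0; have f10 := f0 _ ler01.
  have fu1 : f u <= f 1.
    have u1' : 0 <= 1 - u by rewrite subr_ge0 ltW.
    by rewrite -[in leRHS](subrK u 1) addrC fD// lerDl f0.
  rewrite ler_norml; apply/andP; split; nra.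
Qed.

End additive.

(** * First and second moments of the increments of L *)

Section levy_moments.
Context d (T : measurableType d) (R : realType) (P : probability T R).

Lemma eq_law_Rintegral (X Y : {RV P >-> R}) (f : R -> R) :
  (forall B : set R, measurable B -> P (X @^-1` B) = P (Y @^-1` B)) ->
  measurable_fun setT f ->
  P.-integrable setT (EFin \o (fun w => f (X w))) ->
  P.-integrable setT (EFin \o (fun w => f (Y w))) ->
  \int[P]_w f (X w) = \int[P]_w f (Y w).
Proof.
move=> XY mf iX iY; rewrite /Rintegral; congr fine.
have mEf : measurable_fun setT (EFin \o f) by exact/measurable_EFinP.
rewrite -[LHS](integral_distribution mEf iX) -[RHS](integral_distribution mEf iY).
by apply: eq_measure_integral => B mB _; exact: XY.
Qed.

Variables (L : R -> {RV P >-> R}) (sigma : R).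
Hypotheses (L_levy : levy_process L) (L_second_order : second_order L).
Hypothesis L_mean : ('E_P[L 1%R])%E = 0%E.
Hypothesis L_var : ('E_P[fun w => (L 1 w ^+ 2)%R])%E = (sigma ^+ 2)%:E.

Let rinc (s t : R) : {RV P >-> R} := L t \- L s.
Let inc (s t : R) : T -> R := fun w => L t w - L s w.

Lemma levy_increment_Lfun2 s t : (fun w => L t w - L s w) \in Lfun P 2%:E.
Proof. by apply: Lfun2B; exact: L_second_order. Qed.

Lemma Lfun2_integrable (X : T -> R) : X \in Lfun P 2%:E ->
  P.-integrable setT (EFin \o X).
Proof.
have PT : P setT \is a fin_num by rewrite probability_setT.
by move=> /(Lfun_subset12 PT)/Lfun1_integrable.
Qed.

Let mean t := \int[P]_w (L t w - L 0 w).

Let meanB s t : \int[P]_w (L t w - L s w) = mean t - mean s.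
Proof.
rewrite -RintegralB//; try exact/Lfun2_integrable/levy_increment_Lfun2.
by apply: eq_Rintegral => w _; rewrite opprB addrA subrK.
Qed.

Let mean_shift s t : 0 <= t ->
  \int[P]_w (L (s + t) w - L s w) = mean t.
Proof.
move=> t0; have [_ _ statL _ _] := L_levy.
apply: (@eq_law_Rintegral (rinc s (s + t)) (rinc 0 t) id) => //.
- move=> B mB; have := statL 0 t s B t0 mB.
  by rewrite add0r addrC.
- exact/Lfun2_integrable/levy_increment_Lfun2.
- exact/Lfun2_integrable/levy_increment_Lfun2.
Qed.

Let inner_shift s t : 0 <= t ->
  inner P (inc s (s + t)) (inc s (s + t)) = inner P (inc 0 t) (inc 0 t).
Proof.
move=> t0; have [_ _ statL _ _] := L_levy.
apply: (@eq_law_Rintegral (rinc s (s + t)) (rinc 0 t) (fun x => x * x)) => //.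
- move=> B mB; have := statL 0 t s B t0 mB.
  by rewrite add0r addrC.
- exact: measurable_funM.
- exact: (Lfun2_mul_integrable (levy_increment_Lfun2 _ _)
    (levy_increment_Lfun2 _ _)).
- exact: (Lfun2_mul_integrable (levy_increment_Lfun2 _ _)
    (levy_increment_Lfun2 _ _)).
Qed.

Let meanD s t : 0 <= s -> 0 <= t -> mean (s + t) = mean s + mean t.
Proof. by move=> s0 t0; rewrite -(mean_shift s t0) meanB; ring. Qed.

Let inner_independent s t : 0 <= s -> 0 <= t ->
  inner P (inc 0 s) (inc s (s + t)) = mean s * mean t.
Proof.
move=> s0 t0; have [_ indepL _ _ _] := L_levy.
rewrite -(mean_shift s t0).
apply: (@Rintegral_mul_independent _ _ _ P (rinc 0 s) (rinc s (s + t)));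
  try exact: levy_increment_Lfun2.
move=> A B mA mB.
(* the times 0, s, s + t, continued by s + t to a nondecreasing sequence *)
pose u i := nth (s + t) [:: 0; s] i.
have u_nd : nondecreasing_seq u.
  apply/nondecreasing_seqP => -[|[|i]]; rewrite /u/= ?lerDl//.
  by rewrite !nth_nil.
have := indepL 2 u u_nd (fun i => if i == ord0 then A else B).
rewrite big_ord_recl big_ord1/= => <-; last by move=> i; case: ifP.
congr (P _); apply/seteqP; split => w /=.
  move=> [Aw Bw] i _ /=; case: ifP => [/eqP ->//|i0].
  by have -> : i = 1 :> nat by case: i i0 => -[|[|]].
move=> h; split; first exact: (h ord0 Logic.I).
exact: (h (lift ord0 ord0) Logic.I).
Qed.

Let var t := inner P (inc 0 t) (inc 0 t) - mean t ^+ 2.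

Let varE t : 'V_P[rinc 0 t] = (var t)%:E.
Proof.
have i2 : (rinc 0 t : T -> R) \in Lfun P 2%:E by exact: levy_increment_Lfun2.
rewrite varianceE// /var EFinB -integral_sqr_inner//.
rewrite unlock; congr (_ - _)%E; rewrite EFin_expe /mean /Rintegral fineK//.
exact/integrable_fin_num/Lfun2_integrable.
Qed.

Let var_ge0 t : 0 <= var t.
Proof. by rewrite -lee_fin -varE variance_ge0. Qed.

Let varD s t : 0 <= s -> 0 <= t -> var (s + t) = var s + var t.
Proof.
move=> s0 t0; rewrite /var meanD//.
have i2 a b : inc a b \in Lfun P 2%:E by exact: levy_increment_Lfun2.
have -> : inc 0 (s + t) = (fun w => inc 0 s w + inc s (s + t) w).
  by apply/funext => w; rewrite /inc/=; ring.
rewrite inner_sqrD// inner_shift// inner_independent//.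
by ring.
Qed.

(* For small t, the increment is less than 1/2 in absolute value with
   probability more than 3/4, by continuity in probability, and within 1/2 of
   its mean with probability at least 3/4, by Chebyshev's inequality, as its
   variance is linear in t; both events occur at once. *)
Let mean_bounded :
  exists2 delta, 0 < delta & forall t, 0 <= t < delta -> `|mean t| <= 1.
Proof.
have [_ _ _ cL _] := L_levy.
have h0 : (0 : R) < 2^-1 by lra.
have q0 : (0 : R) < 4^-1 by lra.
have /fine_cvgP[Lfin Lcvg] := cL 0 _ h0.
have [e /= e0 Le] := filterI Lfin (cvgr_lt _ Lcvg _ q0).
have v1 := var_ge0 1.
have v10 : 0 < 16 * (var 1 + 1) by lra.
exists (Num.min e (16 * (var 1 + 1))^-1); first by rewrite lt_min e0 invr_gt0.
move=> t /andP[t0]; rewrite lt_min => /andP[te tv].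
rewrite leNgt; apply/negP => mt.
pose A := [set w | 2^-1 <= `|L t w - L 0 w|].
pose B := [set w | 2^-1 <= `|L t w - L 0 w - mean t|].
have mL : measurable_fun setT (fun w => L t w - L 0 w).
  exact: measurable_funB.
have mge (f : T -> R) : measurable_fun setT f ->
    measurable [set w | 2^-1 <= `|f w|].
  move=> mf; rewrite -[X in measurable X]setTI.
  rewrite (_ : [set w | _] = (Num.norm \o f) @^-1` `[2^-1, +oo[); last first.
    by apply/seteqP; split => w /=; rewrite in_itv/= andbT.
  by apply: measurableT_comp.
have mA : measurable A by exact: mge.
have mB : measurable B by apply: mge; exact: measurable_funB.
have AB : A `|` B = setT.
  apply/seteqP; split => // w _; rewrite /A /B/=.
  case: (leP 2^-1 `|L t w - L 0 w|) => [|h]; first by left.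
  right; rewrite distrC.
  have := lerB_dist (mean t) (L t w - L 0 w).
  by move=> k; lra.
have PA : (P A < (4^-1)%:E)%E.
  have [|fin lt4] := Le t; first by rewrite /ball/= sub0r normrN ger0_norm.
  by rewrite -(fineK fin) lte_fin.
have PB : (P B <= (4^-1)%:E)%E.
  have := chebyshev (rinc 0 t) h0.
  have -> : fine 'E_P[rinc 0 t] = mean t by rewrite unlock.
  move=> /le_trans; apply.
  rewrite varE -EFinM lee_fin (additive_ge0_linear varD) //.
  have : t * (16 * (var 1 + 1)) <= 1.
    by rewrite -ler_pdivlMr// div1r ltW.
  by rewrite exprVn invrK; nra.
have := probability_setT P; rewrite -AB => PAB.
have : (1%:E <= (4^-1)%:E + (4^-1)%:E :> \bar R)%E.
  by rewrite -PAB (le_trans (measureU2 _ mA mB))// leeD// ltW.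
by rewrite -EFinD lee_fin; lra.
Qed.

Let L0_ae : {ae P, forall w, L 0 w = 0}. Proof. by have [] := L_levy. Qed.

Let mean1 : mean 1 = 0.
Proof.
rewrite /mean RintegralB//; try exact/Lfun2_integrable/L_second_order.
rewrite [X in X - _](_ : _ = fine 'E_P[L 1]); last by rewrite unlock.
rewrite L_mean/= sub0r; apply/eqP; rewrite oppr_eq0; apply/eqP.
rewrite /Rintegral -[RHS]/(fine 0%E) -(integral0 P setT); congr fine.
apply: ae_eq_integral => //; first exact/measurable_EFinP.
by apply: filterS L0_ae => w /= ->.
Qed.

Let mean0 t : 0 <= t -> mean t = 0.
Proof.
have [delta d0 md] := mean_bounded.
exact: (additive_bounded_eq0 meanD mean1 d0 md).
Qed.

(** By stationarity the mean is additive in the length of the increment; it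
    vanishes for length 1 and is bounded for small lengths. *)
Lemma levy_increment_mean s t : \int[P]_w (L t w - L s w) = 0.
Proof.
rewrite meanB.
have m0 u : mean u = 0.
  have [u0|/ltW u0] := leP 0 u; first exact: mean0.
  have := @mean_shift u (- u); rewrite oppr_ge0 => /(_ u0).
  rewrite subrr meanB (mean0 (lexx 0)) (@mean0 (- u)) ?oppr_ge0// sub0r.
  by move=> /eqP; rewrite oppr_eq0 => /eqP.
by rewrite !m0 subrr.
Qed.

(** Independence makes the variance additive in the length of the increment,
    and nonnegativity makes it linear; the mean being zero, the variance is the
    second moment. *)
Lemma levy_increment_sqr s t :
  inner P (fun w => L t w - L s w) (fun w => L t w - L s w) =
  sigma ^+ 2 * `|t - s|.
Proof.
have v1 : var 1 = sigma ^+ 2.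
  rewrite /var mean1 expr0n/= subr0; apply: EFin_inj.
  rewrite -integral_sqr_inner -?L_var ?unlock; last exact: levy_increment_Lfun2.
  apply: ae_eq_integral => //.
  - by apply/measurable_EFinP/measurable_funX/measurable_funB.
  - by apply/measurable_EFinP/measurable_funX.
  - by apply: filterS L0_ae => w /= L0 _; rewrite /inc L0 subr0.
wlog st : s t / s <= t.
  move=> H; have [/H//|/ltW/H] := leP s t; rewrite distrC => <-.
  by apply: eq_Rintegral => w _; rewrite -mulrNN !opprB.
have ts : 0 <= t - s by rewrite subr_ge0.
have := inner_shift s ts; rewrite addrC subrK => ->.
have := additive_ge0_linear varD (fun t _ => var_ge0 t) ts.
by rewrite v1 /var mean0// expr0n/= subr0 => ->; rewrite ger0_norm// mulrC.
Qed.

(** Polarization of the previous identity. *)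
Lemma levy_increment_inner s t u v :
  inner P (fun w => L t w - L s w) (fun w => L v w - L u w) =
  sigma ^+ 2 * ((`|t - u| + `|s - v| - `|t - v| - `|s - u|) / 2).
Proof.
have i2 := levy_increment_Lfun2.
have E a b c : inner P (fun w => L a w - L c w) (fun w => L b w - L c w) =
    sigma ^+ 2 * ((`|a - c| + `|b - c| - `|a - b|) / 2).
  have := inner_sqrD (i2 c a) (i2 b c).
  have -> : (fun w => (L a w - L c w) + (L c w - L b w)) =
      (fun w => L a w - L b w) by apply/funext => w; ring.
  rewrite !levy_increment_sqr.
  have -> : inner P (fun w => L a w - L c w) (fun w => L c w - L b w) =
      - inner P (fun w => L a w - L c w) (fun w => L b w - L c w).
    rewrite innerC (innerC _ _ (fun w => L b w - _)) -mulN1r -innerZ//.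
    by congr inner; apply/funext => w; ring.
  rewrite (distrC c b); lra.
have := innerB (i2 u t) (i2 u s) (i2 u v).
have -> : (fun w => (L t w - L u w) - (L s w - L u w)) =
    (fun w => L t w - L s w) by apply/funext => w; ring.
move=> ->; rewrite !E (distrC s u); lra.
Qed.

End levy_moments.

(** * The isometry of the stochastic integral *)

Section step_functions.
Variable R : realType.
Local Notation mu := (@lebesgue_measure R).

Lemma indic_itv_Lfun2 (s t : R) : (\1_`]s, t] : R -> R) \in Lfun mu 2%:E.
Proof.
apply: measurable_Lfun2; first exact: measurable_indic.
rewrite (_ : (\int[mu]_x _)%E = \int[mu]_x (\1_`]s, t] x)%:E)%E; last first.
  by apply: eq_integral => x _; rewrite indicE; case: (_ \in _);
    rewrite ?expr1n// expr0n.
rewrite integral_indic// setIT; have /= -> := lebesgue_measure_itv `]s, t].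
by case: ifP => // _; rewrite -EFinB ltry.
Qed.

(** The length of the intersection of the intervals, written so as to match
    the covariance of the increments obtained by polarization. *)
Lemma inner_indic_itv (s t u v : R) : s <= t -> u <= v ->
  inner mu \1_`]s, t] \1_`]u, v] =
  (`|t - u| + `|s - v| - `|t - v| - `|s - u|) / 2.
Proof.
move=> st uv.
rewrite /inner (_ : (fun x => _) =
    (\1_`]Num.max s u, Num.min t v] : R -> R)); last first.
  apply/funext => x; rewrite -[LHS]/((\1_`]s, t] \* \1_`]u, v]) x) -indicI.
  congr (\1_ _ x); apply/seteqP; split => y /=;
    by rewrite !in_itv/= gt_max le_min; lra.
rewrite /Rintegral integral_indic// setIT.
have /= -> := lebesgue_measure_itv `]Num.max s u, Num.min t v].
rewrite lte_fin (fun_if fine)/= /Num.max /Num.min.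
have nP (x : R) : `|x| = if x < 0 then - x else x.
  by case: ltP => h; [rewrite ltr0_norm|rewrite ger0_norm].
rewrite !nP !subr_lt0.
case: (ltP s u) => su; case: (ltP t v) => tv; case: ltP => h;
  case: (ltP t u) => tu; case: (ltP s v) => sv; lra.
Qed.

Lemma step_fun_Lfun2 (h : seq (R * (R * R))) : step_fun h \in Lfun mu 2%:E.
Proof.
apply: (@Lfun2_sum _ _ _ mu _ h (fun x => x.1) (fun x => \1_`]x.2.1, x.2.2])).
by move=> x _; exact: indic_itv_Lfun2.
Qed.

Lemma inner_step_fun (h : seq (R * (R * R))) g : g \in Lfun mu 2%:E ->
  inner mu (step_fun h) g =
  \sum_(x <- h) x.1 * inner mu \1_`]x.2.1, x.2.2] g.
Proof.
move=> g2; apply: (@inner_sum _ _ _ mu _ h (fun x => x.1)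
  (fun x => \1_`]x.2.1, x.2.2])) => // x _; exact: indic_itv_Lfun2.
Qed.

Section isometry.
Context d (T : measurableType d) (P : probability T R).
Variables (L : R -> {RV P >-> R}) (sigma : R).
Hypotheses (L_levy : levy_process L) (L_second_order : second_order L).
Hypothesis L_mean : ('E_P[L 1%R])%E = 0%E.
Hypothesis L_var : ('E_P[fun w => (L 1 w ^+ 2)%R])%E = (sigma ^+ 2)%:E.

Lemma step_integral_Lfun2 h : step_integral (fun t => L t) h \in Lfun P 2%:E.
Proof.
apply: (@Lfun2_sum _ _ _ P _ h (fun x => x.1)
  (fun x w => L x.2.2 w - L x.2.1 w)).
by move=> x _; exact: levy_increment_Lfun2.
Qed.

Lemma inner_step_integral h X : X \in Lfun P 2%:E ->
  inner P (step_integral (fun t => L t) h) X =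
  \sum_(x <- h) x.1 * inner P (fun w => L x.2.2 w - L x.2.1 w) X.
Proof.
move=> X2; apply: (@inner_sum _ _ _ P _ h (fun x => x.1)
  (fun x w => L x.2.2 w - L x.2.1 w)) => // x _; exact: levy_increment_Lfun2.
Qed.

Lemma step_integral_mean h :
  inner P (step_integral (fun t => L t) h) (cst 1) = 0.
Proof.
have i1 : cst 1 \in Lfun P 2%:E by exact: Lfun_cst.
have i2 := levy_increment_Lfun2 L_second_order.
rewrite inner_step_integral//.
rewrite big1_seq// => x _.
rewrite [X in _ * X](_ : _ = 0) ?mulr0//.
rewrite -[RHS](levy_increment_mean L_levy L_second_order L_mean x.2.1 x.2.2).
by apply: eq_Rintegral => w _; rewrite /= mulr1.
Qed.

Lemma step_integral_isometry h k : step_wf h -> step_wf k ->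
  inner P (step_integral (fun t => L t) h) (step_integral (fun t => L t) k) =
  sigma ^+ 2 * inner mu (step_fun h) (step_fun k).
Proof.
move=> /allP hwf /allP kwf.
have i2 := levy_increment_Lfun2 L_second_order.
have j2 := indic_itv_Lfun2.
rewrite inner_step_integral ?step_integral_Lfun2//.
rewrite inner_step_fun ?step_fun_Lfun2//.
rewrite mulr_sumr; apply: eq_big_seq => x xh; rewrite mulrCA; congr (_ * _).
rewrite innerC [in RHS]innerC.
rewrite inner_step_integral//.
rewrite inner_step_fun//.
rewrite mulr_sumr; apply: eq_big_seq => y yk; rewrite mulrCA; congr (_ * _).
rewrite (levy_increment_inner L_levy L_second_order L_mean L_var).
by rewrite inner_indic_itv//; [exact: kwf|exact: hwf].
Qed.

Lemma stochastic_integral_centered f X : measurable_fun setT f ->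
  is_stochastic_integral P (fun t => L t) f X -> measurable_fun setT X ->
  [/\ f \in Lfun mu 2%:E, X \in Lfun P 2%:E & \int[P]_w X w = 0].
Proof.
move=> mf [h [hwf hf hX]] mX.
have [f2 cf] := cvg_sqr_integral (fun n => step_fun_Lfun2 (h n)) mf hf.
have [X2 cX] := cvg_sqr_integral (fun n => step_integral_Lfun2 (h n)) mX hX.
split=> //.
have i1 : cst 1 \in Lfun P 2%:E by exact: Lfun_cst.
have c1 : inner P (fun w => cst 1 w - cst 1 w) (fun w => cst 1 w - cst 1 w)
    @[n --> \oo] --> (0 : R).
  under [X in X @ _ --> _]eq_fun do
    (rewrite /inner; under eq_Rintegral do rewrite subrr mul0r).
  by rewrite Rintegral_cst// mul0r; exact: cvg_cst.
have c := cvg_inner (fun n => step_integral_Lfun2 (h n)) (fun=> i1) X2 i1 cX c1.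
transitivity (inner P X (cst 1)).
  by apply: eq_Rintegral => w _; rewrite /= mulr1.
apply: cvg_unique c _ => //.
rewrite (_ : (fun _ : nat => _) = (fun=> 0)); first exact: cvg_cst.
by apply/funext => n /=; rewrite step_integral_mean.
Qed.

(** Step functions and their integrals converge in mean square, and the
    inner product is continuous. *)
Lemma stochastic_integral_isometry f g X Y :
  measurable_fun setT f -> measurable_fun setT g ->
  measurable_fun setT X -> measurable_fun setT Y ->
  is_stochastic_integral P (fun t => L t) f X ->
  is_stochastic_integral P (fun t => L t) g Y ->
  inner P X Y = sigma ^+ 2 * inner mu f g.
Proof.
move=> mf mg mX mY [h [hwf hf hX]] [k [kwf kg kY]].
have [f2 cf] := cvg_sqr_integral (fun n => step_fun_Lfun2 (h n)) mf hf.
have [X2 cX] := cvg_sqr_integral (fun n => step_integral_Lfun2 (h n)) mX hX.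
have [g2 cg] := cvg_sqr_integral (fun n => step_fun_Lfun2 (k n)) mg kg.
have [Y2 cY] := cvg_sqr_integral (fun n => step_integral_Lfun2 (k n)) mY kY.
have c1 := cvg_inner (fun n => step_integral_Lfun2 (h n))
  (fun n => step_integral_Lfun2 (k n)) X2 Y2 cX cY.
have c2 := cvg_inner (fun n => step_fun_Lfun2 (h n))
  (fun n => step_fun_Lfun2 (k n)) f2 g2 cf cg.
apply: cvg_unique c1 _ => //.
rewrite (_ : (fun _ : nat => _) = (fun n => sigma ^+ 2 *
    inner mu (step_fun (h n)) (step_fun (k n)))).
  by apply: cvgM c2; exact: cvg_cst.
by apply/funext => n /=; rewrite step_integral_isometry.
Qed.

End isometry.
End step_functions.

(** * Exponential generating functions *)

Section egf.
Variable R : realType.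
Implicit Types (m : nat -> R) (t : R).

Definition egf m t : R := limn (pseries (fun i => m i / i`!%:R) t).

(** This makes egf m an entire function, and is stable under the shift of
    sequences that corresponds to differentiation. *)
Definition exp_bounded m := exists C M : R, forall i, `|m i| <= C * M ^+ i.

Lemma exp_bounded_ge0 m : exp_bounded m ->
  exists C M : R, [/\ 0 <= C, 0 <= M & forall i, `|m i| <= C * M ^+ i].
Proof.
move=> [C [M mCM]]; exists `|C|, `|M|; split=> // i.
by rewrite -normrX -normrM (le_trans (mCM i))// ler_norm.
Qed.

Lemma exp_boundedZ c m : exp_bounded m -> exp_bounded (fun i => c * m i).
Proof.
move=> [C [M mCM]]; exists (`|c| * C), M => i.
by rewrite normrM -mulrA ler_wpM2l.
Qed.

Lemma exp_boundedD m n : exp_bounded m -> exp_bounded n ->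
  exp_bounded (fun i => m i + n i).
Proof.
move=> /exp_bounded_ge0[C [M [C0 M0 mCM]]] /exp_bounded_ge0[D [N [D0 N0 nDN]]].
exists (C + D), (Num.max M N) => i.
rewrite (le_trans (ler_normD _ _))// mulrDl lerD//.
  rewrite (le_trans (mCM i))// ler_wpM2l//.
  by rewrite lerXn2r ?nnegrE ?le_max ?lexx ?M0.
rewrite (le_trans (nDN i))// ler_wpM2l//.
by rewrite lerXn2r ?nnegrE ?le_max ?lexx ?N0 ?orbT.
Qed.

Lemma exp_boundedS m : exp_bounded m -> exp_bounded (fun i => m i.+1).
Proof.
move=> [C [M mCM]]; exists (C * M), M => i.
by rewrite -mulrA -exprS.
Qed.

Lemma is_cvg_egf m t : exp_bounded m ->
  cvgn (pseries (fun i => m i / i`!%:R) t).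
Proof.
move=> /exp_bounded_ge0[C [M [C0 M0 mCM]]].
apply: normed_cvg; apply: (@series_le_cvg _ _
  (fun i => C * exp_coeff (M * `|t|) i)) => [i|i|i|].
- exact: normr_ge0.
- by rewrite mulr_ge0// exp_coeff_ge0// mulr_ge0.
- rewrite /= normrM normrX normrM normfV normr_nat /exp_coeff/= exprMn.
  rewrite [leRHS](_ : _ = C * M ^+ i / i`!%:R * `|t| ^+ i); last by ring.
  rewrite ler_wpM2r ?exprn_ge0// ler_wpM2r ?invr_ge0//.
- rewrite (_ : series _ = (fun n => C * series (exp_coeff (M * `|t|)) n)).
    by apply: is_cvgMr; exact: is_cvg_series_exp_coeff.
  by apply/funext => n; rewrite /series/= mulr_sumr.
Qed.

Lemma egf_sum (I : Type) (s : seq I) (c : I -> R) (m : I -> nat -> R) t :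
  (forall i, exp_bounded (m i)) ->
  egf (fun k => \sum_(i <- s) c i * m i k) t = \sum_(i <- s) c i * egf (m i) t.
Proof.
move=> mb; apply: cvg_lim => //.
rewrite (_ : pseries _ t = (fun n => \sum_(i <- s) c i *
    pseries (fun k => m i k / k`!%:R) t n)); last first.
  apply/funext => n; rewrite /pseries /series/=.
  under [RHS]eq_bigr do rewrite mulr_sumr.
  rewrite exchange_big/=; apply: eq_bigr => k _.
  by rewrite !mulr_suml; apply: eq_bigr => i _; ring.
by apply: cvg_big => [|i _]; [exact: add_continuous|
  apply: cvgM; [exact: cvg_cst|exact: is_cvg_egf]].
Qed.

Lemma egf_zero t : egf (fun=> 0) t = 0.
Proof.
have b0 : exp_bounded (fun=> 0) by exists 0, 0 => i; rewrite normr0 mul0r.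
have := @egf_sum _ [::] (fun=> 0) (fun _ : 'I_0 => fun=> 0) t (fun=> b0).
by rewrite !big_nil.
Qed.

Lemma egf_at0 m : egf m 0 = m 0%N.
Proof.
apply: cvg_lim => //; apply: (@cvg_near_cst _ R^o).
exists 1%N => // -[//|n _] /=.
rewrite /pseries /series/= big_nat_recl//= expr0 mulr1 fact0 divr1.
by rewrite big1 ?addr0// => i _; rewrite expr0n/= mulr0.
Qed.

Lemma is_derive_egf m t : exp_bounded m ->
  is_derive t 1 (egf m) (egf (fun i => m i.+1) t).
Proof.
move=> mb.
have E n : pseries_diffs (fun i => n i / i`!%:R) =
    (fun i => n i.+1 / i`!%:R) :> (nat -> R).
  apply/funext => i; rewrite /pseries_diffs factS natrM.
  by rewrite mulrCA invfM mulVKf ?pnatr_eq0.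
rewrite /egf -E; apply: (@pseries_snd_diffs _ _ (`|t| + 1)).
- exact: is_cvg_egf.
- by rewrite E; exact: is_cvg_egf (exp_boundedS mb).
- by rewrite !E; exact: is_cvg_egf (exp_boundedS (exp_boundedS mb)).
- by rewrite [ltRHS]ger0_norm ?addr_ge0// ltrDl.
Qed.

Lemma continuous_egf m : exp_bounded m -> continuous (egf m).
Proof.
move=> mb t; apply: differentiable_continuous; apply/derivable1_diffP.
by have [] := is_derive_egf t mb.
Qed.

(** The cofactor is again such a function; its continuity at 0 gives the
    behaviour of egf m there. *)
Lemma egf_factor (N : nat) m : exp_bounded m ->
  (forall i, (i < N)%N -> m i = 0) ->
  exists n, [/\ exp_bounded n, n 0%N = m N / N`!%:R &
    forall t, egf m t = t ^+ N * egf n t].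
Proof.
elim: N m => [|N IH] m mb m0.
  by exists m; split => // [|t]; rewrite ?divr1// mul1r.
pose m' i := m i.+1 / i.+1%:R.
have mb' : exp_bounded m'.
  have /exp_bounded_ge0[C [M [C0 M0 mCM]]] := exp_boundedS mb.
  exists C, M => i; rewrite (le_trans _ (mCM i))//.
  by rewrite normrM normfV normr_nat ler_piMr// invf_le1// ler1n.
have [i iN|n [nb n0 nE]] := IH m' mb'; first by rewrite /m' m0 ?mul0r.
exists n; split => [//||t]; first by rewrite n0 /m' factS natrM invfM mulrA.
rewrite exprS -mulrA -nE.
apply: cvg_lim => //; rewrite -(cvg_shiftS).
rewrite (_ : (fun _ => _) =
    (fun k => t * pseries (fun i => m' i / i`!%:R) t k)).
  by apply: cvgM; [exact: cvg_cst|exact: is_cvg_egf].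
apply/funext => k /=; rewrite /pseries /series/= big_nat_recl//=.
rewrite m0// !mul0r add0r mulr_sumr; apply: eq_bigr => i _.
by rewrite /m' factS natrM exprS invfM; ring.
Qed.

End egf.

(** * Complex-valued functions of a real variable *)

Section complex_functions.
Variable R : realType.
Implicit Types (f g : R -> R[i]) (l z : R[i]).

Lemma complex_ReD (x y : R[i]) : complex.Re (x + y) = complex.Re x + complex.Re y.
Proof. by case: x y => [a b] [c e]. Qed.

Lemma complex_ImD (x y : R[i]) : complex.Im (x + y) = complex.Im x + complex.Im y.
Proof. by case: x y => [a b] [c e]. Qed.

Lemma complex_ReM (x y : R[i]) : complex.Re (x * y) =
  complex.Re x * complex.Re y - complex.Im x * complex.Im y.
Proof. by case: x y => [a b] [c e]. Qed.

Lemma complex_ImM (x y : R[i]) : complex.Im (x * y) =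
  complex.Re x * complex.Im y + complex.Im x * complex.Re y.
Proof. by case: x y => [a b] [c e]. Qed.

Lemma complex_Re_sum (I : Type) (s : seq I) (F : I -> R[i]) :
  complex.Re (\sum_(i <- s) F i) = \sum_(i <- s) complex.Re (F i).
Proof. exact: (big_morph _ complex_ReD). Qed.

Lemma complex_Im_sum (I : Type) (s : seq I) (F : I -> R[i]) :
  complex.Im (\sum_(i <- s) F i) = \sum_(i <- s) complex.Im (F i).
Proof. exact: (big_morph _ complex_ImD). Qed.

Lemma complexP (x y : R[i]) :
  complex.Re x = complex.Re y -> complex.Im x = complex.Im y -> x = y.
Proof. by case: x y => [a b] [c e] /= -> ->. Qed.

Definition is_cderive f g := forall t : R,
  is_derive t (1 : R) (fun u => complex.Re (f u)) (complex.Re (g t)) /\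
  is_derive t (1 : R) (fun u => complex.Im (f u)) (complex.Im (g t)).

Lemma is_derive_ext (g h : R -> R) (t x y : R) : (forall u, g u = h u) ->
  x = y -> is_derive t (1 : R) g x -> is_derive t (1 : R) h y.
Proof. by move=> /funext -> ->. Qed.

Lemma is_derive_shift_arg (g : R -> R) (t c x : R) :
  is_derive (t - c) (1 : R) g x -> is_derive t (1 : R) (fun u => g (u - c)) x.
Proof.
move=> gx; have s1 : is_derive t (1 : R) (fun u : R => u - c) 1.
  by apply: is_derive_eq; rewrite subr0.
apply: is_derive_ext (@is_derive1_comp _ g (fun u => u - c) t x 1 gx s1) => //.
by rewrite mulr1.
Qed.

Lemma is_cderive_lin (n : nat) (z : 'I_n -> R[i]) (c : 'I_n -> R) f g :
  is_cderive f g ->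
  is_cderive (fun t => \sum_(k < n) z k * f (t - c k))
    (fun t => \sum_(k < n) z k * g (t - c k)).
Proof.
move=> fg t.
have dR k : is_derive t (1 : R) (fun u => complex.Re (f (u - c k)))
    (complex.Re (g (t - c k))).
  apply: (@is_derive_shift_arg (fun u => complex.Re (f u))).
  by have [] := fg (t - c k).
have dI k : is_derive t (1 : R) (fun u => complex.Im (f (u - c k)))
    (complex.Im (g (t - c k))).
  apply: (@is_derive_shift_arg (fun u => complex.Im (f u))).
  by have [] := fg (t - c k).
pose h k := (complex.Re (z k) \*: (fun u => complex.Re (f (u - c k)))) -
  (complex.Im (z k) \*: (fun u => complex.Im (f (u - c k)))).
pose j k := (complex.Re (z k) \*: (fun u => complex.Im (f (u - c k)))) +
  (complex.Im (z k) \*: (fun u => complex.Re (f (u - c k)))).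
have dh k := is_deriveB (is_deriveZ (complex.Re (z k)) (dR k))
  (is_deriveZ (complex.Im (z k)) (dI k)).
have dj k := is_deriveD (is_deriveZ (complex.Re (z k)) (dI k))
  (is_deriveZ (complex.Im (z k)) (dR k)).
split.
  apply: is_derive_ext (is_derive_sum dh) => [u|].
    by rewrite fct_sumE complex_Re_sum; apply: eq_bigr => k _; rewrite complex_ReM.
  by rewrite complex_Re_sum; apply: eq_bigr => k _; rewrite complex_ReM.
apply: is_derive_ext (is_derive_sum dj) => [u|].
  by rewrite fct_sumE complex_Im_sum; apply: eq_bigr => k _; rewrite complex_ImM.
by rewrite complex_Im_sum; apply: eq_bigr => k _; rewrite complex_ImM.
Qed.

(** The function s |-> e^(l s) f(t - s) has derivative 0, so it takes the same
    value at 0 and at D. *)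
Lemma cderive_eigen f l : is_cderive f (fun t => l * f t) ->
  forall t D, f t = expC (l * D%:C%C) * f (t - D).
Proof.
move=> fl t D.
pose al := complex.Re l; pose be := complex.Im l.
pose u s := complex.Re (f (t - s)); pose v s := complex.Im (f (t - s)).
have tm s : is_derive s (1 : R) (fun s : R => t - s) (- 1).
  by apply: is_derive_eq; rewrite add0r mul1r.
have du s : is_derive s (1 : R) u (- (al * u s - be * v s)).
  have [dRe _] := fl (t - s).
  apply: is_derive_ext (@is_derive1_comp _ (fun y => complex.Re (f y))
    (fun s => t - s) s _ _ dRe (tm s)) => //.
  by rewrite complex_ReM mulrN1.
have dv s : is_derive s (1 : R) v (- (al * v s + be * u s)).
  have [_ dIm] := fl (t - s).
  apply: is_derive_ext (@is_derive1_comp _ (fun y => complex.Im (f y))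
    (fun s => t - s) s _ _ dIm (tm s)) => //.
  by rewrite complex_ImM mulrN1.
have lin (c s : R) : is_derive s (1 : R) (fun s : R => c * s) c.
  apply: is_derive_ext (is_deriveZ c (is_derive_id s (1 : R))) => //.
  by rewrite /GRing.scale/= mulr1.
pose e s := expR (al * s); pose c s := cos (be * s); pose q s := sin (be * s).
have de s : is_derive s (1 : R) e (e s * al).
  exact: (@is_derive1_comp _ expR (fun s => al * s) s _ _
    (is_derive_expR _) (lin al s)).
have dc s : is_derive s (1 : R) c (- q s * be).
  exact: (@is_derive1_comp _ cos (fun s => be * s) s _ _
    (is_derive_cos _) (lin be s)).
have dq s : is_derive s (1 : R) q (c s * be).
  exact: (@is_derive1_comp _ sin (fun s => be * s) s _ _
    (is_derive_sin _) (lin be s)).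
(* the real and imaginary parts of e^(l s) f(t - s) *)
pose hR : R -> R := e * (c * u - q * v); pose hI : R -> R := e * (c * v + q * u).
have hR0 s : is_derive s (1 : R) hR 0.
  apply: is_derive_eq; rewrite /GRing.scale/=.
  rewrite -[(c * u - q * v) s]/(c s * u s - q s * v s); ring.
have hI0 s : is_derive s (1 : R) hI 0.
  apply: is_derive_eq; rewrite /GRing.scale/=.
  rewrite -[(c * v + q * u) s]/(c s * v s + q s * u s); ring.
have hRE := is_derive_0_is_cst 0 D hR0; have hIE := is_derive_0_is_cst 0 D hI0.
have E0 : [/\ e 0 = 1, c 0 = 1, q 0 = 0, u 0 = complex.Re (f t) &
    v 0 = complex.Im (f t)].
  by rewrite /e /c /q /u /v !mulr0 expR0 cos0 sin0 subr0.
have [e0 c0 q0 u0 v0] := E0.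
have lRe : complex.Re (l * D%:C%C) = al * D by rewrite complex_ReM /= mulr0 subr0.
have lIm : complex.Im (l * D%:C%C) = be * D by rewrite complex_ImM /= mulr0 add0r.
apply: complexP.
  rewrite complex_ReM /expC /= lRe lIm.
  transitivity (hR 0).
    rewrite -[hR 0]/(e 0 * (c 0 * u 0 - q 0 * v 0)) e0 c0 q0 u0; ring.
  rewrite hRE -[hR D]/(e D * (c D * u D - q D * v D)) /e /c /q /u /v; ring.
rewrite complex_ImM /expC /= lRe lIm.
transitivity (hI 0).
  rewrite -[hI 0]/(e 0 * (c 0 * v 0 + q 0 * u 0)) e0 c0 q0 v0; ring.
rewrite hIE -[hI D]/(e D * (c D * v D + q D * u D)) /e /c /q /u /v; ring.
Qed.

End complex_functions.

(** * Lag polynomials annihilating exponential solutions *)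

Section annihilation.
Variable R : realType.
Implicit Types (nu : nat -> R[i]) (f : R -> R[i]) (l z : R[i]).
Implicit Types (Q : {poly R[i]}) (s : seq R[i]).

Lemma sum_coef_widen (A : nzRingType) (p : {poly A}) (n : nat) (h : nat -> A) :
  (size p <= n)%N ->
  \sum_(k < size p) p`_k * h k = \sum_(k < n) p`_k * h k.
Proof.
move=> pn; rewrite -(big_mkord xpredT (fun k => p`_k * h k)).
rewrite -(big_mkord xpredT (fun k => p`_k * h k)) (big_cat_nat _ pn)//=.
rewrite [X in _ + X]big1_seq ?addr0// => k.
rewrite mem_index_iota => /andP[_ /andP[pk _]].
by rewrite nth_default// mul0r.
Qed.

(** Q(B) f, for the backward shift B by D. *)
Definition lagop (D : R) Q f (t : R) : R[i] :=
  \sum_(k < size Q) Q`_k * f (t - k%:R * D).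

Lemma coef_lag_factor z Q k :
  ((1 - z *: 'X) * Q)`_k = Q`_k - z * (if k is j.+1 then Q`_j else 0).
Proof.
by rewrite mulrBl mul1r coefB -scalerAl coefZ coefXM; case: k.
Qed.

Lemma size_lag_factor z Q : (size ((1 - z *: 'X) * Q)%R <= (size Q).+1)%N.
Proof.
apply/leq_sizeP => j Qj; rewrite coef_lag_factor.
case: j Qj => // j Qj; rewrite !nth_default ?mulr0 ?subrr//.
exact: ltnW Qj.
Qed.

Lemma lagop_factor D z Q f t :
  lagop D ((1 - z *: 'X) * Q) f t = lagop D Q f t - z * lagop D Q f (t - D).
Proof.
rewrite /lagop (sum_coef_widen (fun k => f (t - k%:R * D)) (size_lag_factor z Q)).
under eq_bigr do rewrite coef_lag_factor mulrBl.
rewrite sumrB -(sum_coef_widen (fun k => f (t - k%:R * D)))//; congr (_ - _).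
rewrite big_ord_recl mulr0 mul0r add0r mulr_sumr; apply: eq_bigr => k _.
by rewrite mulrA; congr (_ * f _); rewrite /= -nat1r; ring.
Qed.

Definition cegf nu (t : R) : R[i] :=
  (egf (fun i => complex.Re (nu i)) t +i* egf (fun i => complex.Im (nu i)) t)%C.

Definition cexp_bounded nu := exp_bounded (fun i => complex.Re (nu i)) /\
  exp_bounded (fun i => complex.Im (nu i)).

(** With nu i the i-th derivative at 0 of cegf nu, this is the effect on the
    coefficients of the differential operator that is the product of the
    d/dt - l, for l in s. *)
Fixpoint diffop s nu : nat -> R[i] :=
  if s is l :: s' then diffop s' (fun i => nu i.+1 - l * nu i) else nu.

Lemma is_cderive_cegf nu : cexp_bounded nu ->
  is_cderive (cegf nu) (cegf (fun i => nu i.+1)).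
Proof. by move=> [bR bI] t; split; exact: is_derive_egf. Qed.

Lemma egf_lin2 (m n r : nat -> R) (x y : R) t :
  exp_bounded m -> exp_bounded n -> exp_bounded r ->
  exp_bounded (fun i => m i + x * n i + y * r i) /\
  egf (fun i => m i + x * n i + y * r i) t =
  egf m t + x * egf n t + y * egf r t.
Proof.
move=> mb nb rb; split.
  by apply: exp_boundedD (exp_boundedZ _ rb); apply: exp_boundedD (exp_boundedZ _ nb).
have := @egf_sum _ 'I_3 (index_enum _) (fun i => nth 0 [:: 1; x; y] i)
  (fun i => nth m [:: m; n; r] i) t.
rewrite !big_ord_recl big_ord0/= mul1r addr0 => E.
rewrite -addrA -E; last by move=> [[|[|[|]]]].
by congr egf; apply/funext => i; rewrite !big_ord_recl big_ord0/= mul1r addr0 addrA.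
Qed.

Lemma cegf_diff l nu t : cexp_bounded nu ->
  cexp_bounded (fun i => nu i.+1 - l * nu i) /\
  cegf (fun i => nu i.+1 - l * nu i) t =
    cegf (fun i => nu i.+1) t - l * cegf nu t.
Proof.
move=> [bR bI].
have [R1 R2] :=
  egf_lin2 (- complex.Re l) (complex.Im l) t (exp_boundedS bR) bR bI.
have [I1 I2] :=
  egf_lin2 (- complex.Re l) (- complex.Im l) t (exp_boundedS bI) bI bR.
have ReE : (fun i => complex.Re (nu i.+1 - l * nu i)) =
    (fun i => complex.Re (nu i.+1) + - complex.Re l * complex.Re (nu i) +
      complex.Im l * complex.Im (nu i)).
  apply/funext => i; rewrite -mulNr complex_ReD complex_ReM.
  by case: l {R1 R2 I1 I2} => x y /=; ring.
have ImE : (fun i => complex.Im (nu i.+1 - l * nu i)) =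
    (fun i => complex.Im (nu i.+1) + - complex.Re l * complex.Im (nu i) +
      - complex.Im l * complex.Re (nu i)).
  apply/funext => i; rewrite -mulNr complex_ImD complex_ImM.
  by case: l {R1 R2 I1 I2 ReE} => x y /=; ring.
split; first by split; rewrite ?ReE ?ImE.
apply: complexP.
  rewrite /= ReE R2 -mulNr complex_ReD complex_ReM /=.
  by case: l {R1 R2 I1 I2 ReE ImE} => x y /=; ring.
rewrite /= ImE I2 -mulNr complex_ImD complex_ImM /=.
by case: l {R1 R2 I1 I2 ReE ImE} => x y /=; ring.
Qed.

(** The product of the d/dt - l annihilates f = cegf nu. Induction on s: if
    Q(B) annihilates f' - l f, then w = Q(B) f satisfies w' = l w, so that w is
    annihilated by 1 - e^(l D) B. Multiple roots need no separate treatment. *)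
Lemma lagop_cegf_eq0 D s nu :
  cexp_bounded nu -> (forall i, diffop s nu i = 0) -> forall t,
  lagop D (\prod_(l <- s) (1 - expC (l * D%:C%C) *: 'X)) (cegf nu) t = 0.
Proof.
elim: s nu => [|l s IH] nu nub /= nu0 t.
  rewrite big_nil /lagop size_poly1 big_ord1 mul0r subr0 coef1 mul1r.
  have -> : nu = (fun=> 0) by apply/funext.
  by apply: complexP; rewrite /= egf_zero.
rewrite big_cons lagop_factor; set Q := \prod_(l <- s) _.
have [db _] := cegf_diff l 0 nub.
have Qd u : lagop D Q (cegf (fun i => nu i.+1)) u = l * lagop D Q (cegf nu) u.
  apply/eqP; rewrite -subr_eq0 -(IH _ db nu0 u); apply/eqP.
  rewrite /lagop mulr_sumr -sumrB; apply: eq_bigr => k _.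
  by rewrite (cegf_diff l _ nub).2; ring.
have w' : is_cderive (lagop D Q (cegf nu)) (fun u => l * lagop D Q (cegf nu) u).
  rewrite -(funext Qd); exact: is_cderive_lin (is_cderive_cegf nub).
by rewrite -(cderive_eigen w' t D) subrr.
Qed.

End annihilation.

(** * The kernel as a generating function *)

Section moments.
Variable R : realType.

(** The derivatives at 0 of t |-> b exp(t A) e. *)
Definition moment m (b : 'rV[R]_m) (A : 'M[R]_m) (e : 'cV[R]_m) (k : nat) : R :=
  (b *m A ^+ k *m e) 0 0.

Lemma exp_bounded_power_entry m (A : 'M[R]_m) i j : exp_bounded (fun k => (A ^+ k) i j).
Proof.
pose M := \sum_(j < m) \sum_(l < m) `|A l j|.
exists 1, M => k; rewrite mul1r; elim: k i j => [|k IH] i j.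
  by rewrite !expr0 mxE; case: (_ == _); rewrite ?normr1 ?normr0.
have M0 : 0 <= M by rewrite sumr_ge0// => l _; rewrite sumr_ge0.
rewrite exprSr mxE (le_trans (ler_norm_sum _ _ _))//.
rewrite exprSr (@le_trans _ _ (M ^+ k * \sum_(l < m) `|A l j|))//.
  by rewrite mulr_sumr ler_sum// => l _; rewrite normrM ler_wpM2r.
rewrite ler_wpM2l ?exprn_ge0// /M [leRHS](bigD1 j)//= lerDl sumr_ge0// => l _.
by rewrite sumr_ge0.
Qed.

Lemma expmxE m (A : 'M[R]_m) t i j :
  expmx (t *: A) i j = egf (fun k => (A ^+ k) i j) t.
Proof.
rewrite mxE /egf /pseries; congr (limn (series _)); apply/funext => k.
rewrite (_ : (t *: A) ^+ k = t ^+ k *: A ^+ k) ?mxE /=; first by ring.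
elim: k => [|k IH]; first by rewrite !expr0 scale1r.
by rewrite !exprS IH -!mulmxE -scalemxAl -scalemxAr scalerA.
Qed.

Lemma momentE m (b : 'rV[R]_m) (A : 'M[R]_m) (e : 'cV[R]_m) :
  moment b A e = fun k => \sum_(x <- index_enum (('I_m * 'I_m)%type : finType))
    b 0 x.1 * e x.2 0 * (A ^+ k) x.1 x.2.
Proof.
apply/funext => k; rewrite /moment mxE.
rewrite -(pair_bigA _ (fun i j => b 0 i * e j 0 * (A ^+ k) i j))/=.
rewrite exchange_big/=; apply: eq_bigr => j _; rewrite mxE mulr_suml.
by apply: eq_bigr => i _; ring.
Qed.

Lemma exp_bounded_moment m (b : 'rV[R]_m) (A : 'M[R]_m) (e : 'cV[R]_m) :
  exp_bounded (moment b A e).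
Proof.
rewrite momentE.
elim: (index_enum _) => [|x s IH].
  by exists 0, 0 => i; rewrite big_nil normr0 mul0r.
rewrite (_ : (fun k => _) = (fun k => b 0 x.1 * e x.2 0 * (A ^+ k) x.1 x.2 +
   \sum_(x <- s) b 0 x.1 * e x.2 0 * (A ^+ k) x.1 x.2)).
  by apply: exp_boundedD IH; apply: exp_boundedZ; exact: exp_bounded_power_entry.
by apply/funext => k; rewrite big_cons.
Qed.

Lemma expmx_moment m (b : 'rV[R]_m) (A : 'M[R]_m) (e : 'cV[R]_m) t :
  (b *m expmx (t *: A) *m e) 0 0 = egf (moment b A e) t.
Proof.
rewrite momentE.
rewrite egf_sum; last by move=> x; exact: exp_bounded_power_entry.
rewrite -(pair_bigA _ (fun i j =>
  b 0 i * e j 0 * egf (fun k => (A ^+ k) i j) t))/=.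
rewrite mxE exchange_big/=; apply: eq_bigr => j _; rewrite mxE mulr_suml.
by apply: eq_bigr => i _; rewrite expmxE; ring.
Qed.

(** By the Cayley-Hamilton theorem, the moments satisfy the linear recurrence
    given by the characteristic polynomial. *)
Lemma diffop_moment_eq0 m (b : 'rV[R]_m) (A : 'M[R]_m) (e : 'cV[R]_m)
    (s : seq R[i]) :
  polyC_of (char_poly A) = \prod_(l <- s) ('X - l%:P) ->
  forall k, diffop s (fun k => (moment b A e k)%:C%C) k = 0.
Proof.
case: m b A e => [|m] b A e As.
  have D0 nu : (forall k, nu k = 0) -> forall k, diffop s nu k = 0 :> R[i].
    elim: s {As} nu => [|l s IH] nu nu0 k /=; first exact: nu0.
    by apply: IH => {}k; rewrite !nu0 mulr0 subrr.
  by apply: D0 => k; rewrite /moment mxE big_ord0.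
pose AC := map_mx (real_complex R) A.
pose F (Q : {poly R[i]}) := (map_mx (real_complex R) b *m horner_mx AC Q *m
  map_mx (real_complex R) e) 0 0.
have FB z P Q : F (P - z *: Q) = F P - z * F Q.
  rewrite /F rmorphB/= linearZ/= mulmxBr mulmxBl -scalemxAr -scalemxAl.
  by rewrite [LHS]mxE [X in _ + X]mxE [X in - X]mxE.
have FE Q k : F (polyC_of (char_poly A) * Q * 'X^k) = 0.
  rewrite /F /polyC_of rmorphM/= rmorphM/= -map_horner_mx Cayley_Hamilton.
  by rewrite map_mx0 !mul0r mulmx0 mul0mx mxE.
have FX k : (moment b A e k)%:C%C = F (1 * 'X^k).
  rewrite mul1r /F rmorphXn/= horner_mx_X -rmorphXn/= -!map_mxM mxE//.
have FD t Q nu : (forall k, nu k = F (Q * 'X^k)) ->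
    forall k, diffop t nu k = F (Q * \prod_(l <- t) ('X - l%:P) * 'X^k).
  elim: t Q nu => [|l t IH] Q nu nuF k /=; first by rewrite big_nil mulr1.
  rewrite (IH (Q * ('X - l%:P))); first by rewrite big_cons mulrA.
  move=> j; rewrite !nuF -FB; congr F.
  by rewrite mulrBr mulrBl -mulrA -exprS mulrAC (mulrC _ l%:P) mul_polyC.
by move=> k; rewrite (FD s 1 _ FX) -As mul1r -[polyC_of _]mulr1 FE.
Qed.

(** Multiplication by the companion matrix moves the entries of a column up
    by one place, so that the leading 1 of A^k e_p stands at height p - k. *)
Lemma companion_power_last (a : {poly R}) (k : nat) (i : 'I_(size a).-1) :
  (i + k < (size a).-1)%N ->
  (companionmx a ^+ k *m \col_(j < (size a).-1) (j.+1 == (size a).-1)%:R) i 0 =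
  ((i + k).+1 == (size a).-1)%:R.
Proof.
elim: k i => [|k IH] i ik.
  by rewrite expr0 mul1mx mxE addn0.
rewrite exprS -mulmxE -mulmxA mxE.
have ip : (i.+1 < (size a).-1)%N.
  by rewrite (leq_ltn_trans _ ik)// addnS ltnS leq_addr.
have cE j : companionmx a i j = (i.+1 == j :> nat)%:R.
  by rewrite mxE ifF// ltn_eqF// ltn_predRL.
rewrite (bigD1 (Ordinal ip))//= big1 => [|j ji].
  by rewrite addr0 cE eqxx mul1r IH/= addSnnS.
rewrite cE; case: eqP => [ij|_]; last by rewrite mul0r.
by case/eqP: ji; exact/val_inj.
Qed.

Definition carma_moment (a b : {poly R}) : nat -> R :=
  moment (\row_(j < (size a).-1) b`_j) (companionmx a)
    (\col_(i < (size a).-1) (i.+1 == (size a).-1)%:R).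

Lemma carma_kernelE (a b : {poly R}) t :
  carma_kernel a b t = if 0 < t then egf (carma_moment a b) t else 0.
Proof. by rewrite /carma_kernel expmx_moment. Qed.

(** The kernel and its derivatives vanish at 0+ up to the order p - q - 2. *)
Lemma carma_moment_lt (a b : {poly R}) (q k : nat) :
  ((q + k).+1 < (size a).-1)%N ->
  (forall j, (q < j < (size a).-1)%N -> b`_j = 0) ->
  carma_moment a b k = 0.
Proof.
move=> qk bq; rewrite /carma_moment /moment -mulmxA mxE big1// => i _; rewrite mxE.
have [iq|qi] := leqP i q; last by rewrite bq ?mul0r// qi ltn_ord.
have ik : ((i + k).+1 < (size a).-1)%N.
  by rewrite (leq_ltn_trans _ qk)// ltnS leq_add2r.
by rewrite companion_power_last ?(ltnW ik)// ltn_eqF// mulr0.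
Qed.

Lemma carma_moment_eq (a b : {poly R}) (q k : nat) :
  (q + k).+1 = (size a).-1 -> b`_q = 1 ->
  (forall j, (q < j < (size a).-1)%N -> b`_j = 0) ->
  carma_moment a b k = 1.
Proof.
move=> qk bq1 bq; have qp : (q < (size a).-1)%N by rewrite -qk ltnS leq_addr.
rewrite /carma_moment /moment -mulmxA mxE (bigD1 (Ordinal qp))//= big1 => [|i iq].
  by rewrite mxE/= bq1 companion_power_last/= qk ?eqxx ?mulr1 ?addr0 ?leqnn.
rewrite mxE; have [qi|iq'] := ltnP q i; first by rewrite bq ?mul0r// qi ltn_ord.
have ik : ((i + k).+1 < (size a).-1)%N.
  rewrite -[ltnRHS]qk ltnS ltn_add2r ltn_neqAle iq' andbT.
  by apply: contra iq => /eqP iE; apply/eqP/val_inj.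
by rewrite companion_power_last ?(ltnW ik)// ltn_eqF// mulr0.
Qed.

End moments.

(** * The autocovariance as an inner product of kernels *)

Section filtered_sampling.
Variable R : realType.

Lemma ar_poly_seq (p : nat) (lambda : 'I_p -> R[i]) D :
  ar_poly lambda D =
  \prod_(l <- [seq lambda j | j <- enum 'I_p]) (1 - expC (l * D%:C%C) *: 'X).
Proof. by rewrite big_map big_enum. Qed.

Lemma size_lag_prod (s : seq R[i]) (D : R) :
  (size (\prod_(l <- s) (1 - expC (l * D%:C%C) *: 'X))%R <= (size s).+1)%N.
Proof.
elim: s => [|l s IH]; first by rewrite big_nil size_poly1.
by rewrite big_cons (leq_trans (size_lag_factor _ _)).
Qed.

Lemma size_ar_poly (p : nat) (lambda : 'I_p -> R[i]) D :
  (size (ar_poly lambda D) <= p.+1)%N.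
Proof.
by rewrite ar_poly_seq (leq_trans (size_lag_prod _ _))// size_map size_enum_ord.
Qed.

Lemma filteredE (T : Type) (Q : {poly R[i]}) (m : nat) (Y : R -> T -> R) D n w :
  (size Q <= m)%N ->
  filtered Q (sampled Y D) n w =
  \sum_(0 <= k < m) complex.Re Q`_k * Y ((n - k%:Z)%:~R * D) w.
Proof.
move=> Qm; rewrite /filtered.
have bE k : iter k (@backshift R T) (sampled Y D) n = Y ((n - k%:Z)%:~R * D).
  elim: k n => [|k IH] n; first by rewrite /= subr0.
  by rewrite iterS /backshift IH; congr (Y (_%:~R * _)); lia.
under eq_bigr do rewrite bE.
rewrite -(big_mkord xpredT
  (fun k => complex.Re Q`_k * Y ((n - k%:Z)%:~R * D) w)).
rewrite [RHS](big_cat_nat _ Qm)//= [X in _ = _ + X]big1_seq ?addr0// => k.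
rewrite mem_index_iota => /andP[_ /andP[Qk _]].
by rewrite nth_default// mul0r.
Qed.

End filtered_sampling.

Section autocovariance_inner.
Context (R : realType) d (T : measurableType d) (P : probability T R).
Local Notation mu := (@lebesgue_measure R).

Lemma autocovariance_inner (X : int -> T -> R) n :
  (forall m, X m \in Lfun P 2%:E) -> (forall m, \int[P]_w X m w = 0) ->
  autocovariance P X n = inner P (X n%:Z) (X 0).
Proof.
move=> X2 X0; have PT : P setT \is a fin_num by rewrite probability_setT.
rewrite /autocovariance covarianceE ?Lfun2_mul_Lfun1//;
  try exact: Lfun_subset12.
have E0 m : ('E_P[X m] = 0)%E.
  rewrite unlock -[LHS]fineK; last exact/integrable_fin_num/Lfun2_integrable.
  by rewrite -[X in X%:E]/(\int[P]_w X m w) X0.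
by rewrite !E0 mule0 sube0 unlock.
Qed.

Variables (L : R -> {RV P >-> R}) (sigma : R).
Hypotheses (L_levy : levy_process L) (L_second_order : second_order L).
Hypothesis L_mean : ('E_P[L 1%R])%E = 0%E.
Hypothesis L_var : ('E_P[fun w => (L 1 w ^+ 2)%R])%E = (sigma ^+ 2)%:E.

(** The filtered process at time m is the stochastic integral of F m. *)
Lemma gammaMA_inner (g : R -> R) (Y : R -> {RV P >-> R}) p
    (lambda : 'I_p -> R[i]) n D :
  measurable_fun setT g ->
  (forall t, is_stochastic_integral P (fun u => L u)
    (fun u => g (t - u)) (Y t)) ->
  let F (m : int) (u : R) := \sum_(0 <= k < p.+1)
    complex.Re (ar_poly lambda D)`_k * g ((m - k%:Z)%:~R * D - u) in
  [/\ F n%:Z \in Lfun mu 2%:E, F 0 \in Lfun mu 2%:E &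
  gammaMA P (fun t => Y t) lambda n D = sigma ^+ 2 * inner mu (F n%:Z) (F 0)].
Proof.
move=> mg Yg F.
have mgt (t : R) : measurable_fun setT (fun u : R => g (t - u)).
  by apply: (measurableT_comp mg); exact: measurable_funB.
have gY t := stochastic_integral_centered L_levy L_second_order L_mean
  (mgt t) (Yg t) (measurable_funP (Y t)).
have g2 t : (fun u => g (t - u)) \in Lfun mu 2%:E by have [] := gY t.
have Y2 t : (Y t : T -> R) \in Lfun P 2%:E by have [] := gY t.
have Y0 t : \int[P]_w Y t w = 0 by have [] := gY t.
pose c k := complex.Re (ar_poly lambda D)`_k.
have F2 m : F m \in Lfun mu 2%:E.
  exact: (@Lfun2_sum _ _ _ mu _ (index_iota 0 p.+1) c
    (fun k u => g ((m - k%:Z)%:~R * D - u))).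
have XE m : filtered (ar_poly lambda D) (sampled (fun t => Y t) D) m =
   (fun w => \sum_(0 <= k < p.+1) c k * Y ((m - k%:Z)%:~R * D) w).
  by apply/funext => w; rewrite (filteredE _ _ _ _ (size_ar_poly _ _)).
split => //.
have X2 m :
    filtered (ar_poly lambda D) (sampled (fun t => Y t) D) m \in Lfun P 2%:E.
  by rewrite XE; apply: Lfun2_sum.
have i1 : cst 1 \in Lfun P 2%:E by exact: Lfun_cst.
rewrite /gammaMA autocovariance_inner//; last first.
  move=> m; transitivity (inner P
      (filtered (ar_poly lambda D) (sampled (fun t => Y t) D) m) (cst 1)).
    by apply: eq_Rintegral => w _; rewrite mulr1.
  rewrite XE inner_sum// big1_seq// => k _.
  rewrite [X in _ * X](_ : _ = 0) ?mulr0// -[RHS](Y0 ((m - k%:Z)%:~R * D)).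
  by apply: eq_Rintegral => w _; rewrite mulr1.
have isom s t := stochastic_integral_isometry L_levy L_second_order L_mean L_var
  (mgt s) (mgt t) (measurable_funP (Y s)) (measurable_funP (Y t)) (Yg s) (Yg t).
rewrite XE inner_sum// /F inner_sum//; last exact: F2.
rewrite mulr_sumr; apply: eq_bigr => k _; rewrite mulrCA; congr (_ * _).
rewrite innerC [in RHS]innerC XE inner_sum// inner_sum//.
rewrite mulr_sumr; apply: eq_bigr => h _; rewrite mulrCA; congr (_ * _).
exact: isom.
Qed.

End autocovariance_inner.

(** * Integration over cells of length D *)

Section cells.
Variable R : realType.
Local Notation mu := (@lebesgue_measure R).
Variable D : R.
Hypothesis D0 : 0 < D.

Let cell (i : nat) : set R := `[- (i.+1%:R * D), - (i%:R * D)[.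

Lemma Rintegral_cells (M : nat) (f : R -> R) :
  mu.-integrable setT (EFin \o f) ->
  (forall u, u < - (M%:R * D) -> f u = 0) -> (forall u, 0 <= u -> f u = 0) ->
  \int[mu]_u f u = \sum_(0 <= i < M) \int[mu]_(u in cell i) f u.
Proof.
move=> fint fl fr.
pose J (m : nat) : set R := `[- (m%:R * D), 0[%classic.
have -> : \int[mu]_u f u = \int[mu]_(u in J M) f u.
  rewrite [RHS]Rintegral_mkcond; apply: eq_Rintegral => u _.
  rewrite patchE; case: ifPn => // /negP uJ.
  have [u0|u0] := leP 0 u; first by rewrite fr.
  rewrite fl// ltNge; apply/negP => h; apply: uJ.
  by apply/mem_set; rewrite /J/= in_itv/= h.
elim: M {fl} => [|m IH].
  rewrite big_geq// /J mul0r oppr0 set_itv_ge ?Rintegral_set0//.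
  by rewrite -leNgt bnd_simp.
rewrite big_nat_recr//= -IH addrC.
have JE : J m.+1 = cell m `|` J m.
  rewrite /J /cell; apply/seteqP; split => u /=;
    rewrite !in_itv/= -nat1r mulrDl mul1r.
    move=> /andP[h0 h1]; have [h|h] := ltP u (- (m%:R * D)); [left|right];
      apply/andP; split; lra.
  have mD : 0 <= m%:R * D by rewrite mulr_ge0// ltW.
  move=> [/andP[h0 h1]|/andP[h0 h1]]; apply/andP; split=> //.
    by rewrite (lt_le_trans h1)// oppr_le0.
  by rewrite (le_trans _ h0)// lerN2 lerDr ltW.
rewrite JE Rintegral_setU//.
- exact: measurable_itv.
- exact: measurable_itv.
- by apply: integrableS fint => //; apply: measurableU; exact: measurable_itv.
- apply/disj_setPS => u [] /= /andP[_ h1] /andP[h2 _].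
  by move: (lt_le_trans h1 h2); rewrite ltxx.
Qed.

Lemma Rintegral_cell (i : nat) (f h : R -> R) : continuous h ->
  (forall s, 0 < s <= 1 -> f (- ((s + i%:R) * D)) = h s) ->
  \int[mu]_(u in cell i) f u = D * \int[mu]_(s in `[0, 1]) h s.
Proof.
move=> ch fh.
pose G u := h (- u / D - i%:R).
have cG : continuous G.
  have -> : G = h \o (fun u => - u / D - i%:R) by [].
  move=> u; apply: continuous_comp; last exact: ch.
  by apply: cvgB; [apply: cvgM; [apply: cvgN|]|]; try exact: cvg_cst.
have -> : \int[mu]_(u in cell i) f u = \int[mu]_(u in cell i) G u.
  apply: eq_Rintegral => u; rewrite inE => /andP[/= u0 u1].
  rewrite /G -fh; first by congr f; field; rewrite gt_eqF.
  move: u0 u1; rewrite -nat1r => u0 u1.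
  apply/andP; split; first by rewrite subr_gt0 ltr_pdivlMr// ltrNr.
  by rewrite lerBlDr ler_pdivrMr// lerNl.
rewrite Rintegral_itv_bndo_bndc; last first.
  apply: integrableS (continuous_compact_integrable
    (@segment_compact _ (- (i.+1%:R * D)) (- (i%:R * D))) _) => //.
  - exact: subset_itv_co_cc.
  - exact: continuous_subspaceT.
pose F (s : R) := - ((s + i%:R) * D).
have dF s : is_derive s (1 : R) F (- D).
  apply: is_derive_ext (is_deriveB (is_deriveZ (- D) (is_derive_id s (1 : R)))
    (is_derive_cst (i%:R * D) s 1)) => [t|].
    by rewrite -[LHS]/(- D * t - i%:R * D) /F; ring.
  by rewrite subr0; exact: mulr1.
have F'E : derive1 F = cst (- D).
  by apply/funext => s; rewrite derive1E; apply: derive_val.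
have cF : continuous F.
  move=> s; apply: differentiable_continuous; apply/derivable1_diffP.
  by have [] := dF s.
have := @integration_by_substitution_decreasing R F G 0 1 ler01.
have -> : F 0 = - (i%:R * D) by rewrite /F add0r.
have -> : F 1 = - (i.+1%:R * D) by rewrite /F nat1r.
rewrite F'E {1}/Rintegral => ->.
- rewrite -RintegralZl//.
    rewrite /Rintegral; congr fine; apply: eq_integral => s _.
    rewrite /= !fctE opprK mulrC /G /F; congr (_ * h _)%:E.
    by field; rewrite gt_eqF.
  by apply: continuous_compact_integrable;
    [exact: segment_compact|exact: continuous_subspaceT].
- by move=> x y _ _ xy; rewrite /F ltrN2 ltr_pM2r// ltrD2r.
- by move=> ? ?; exact: cvg_cst.
- exact: is_cvg_cst.
- exact: is_cvg_cst.
- split => [x _||].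
  + by have [] := dF x.
  + by apply: cvg_at_right_filter; exact: cF.
  + by apply: cvg_at_left_filter; exact: cF.
- exact: continuous_subspaceT.
Qed.

End cells.

(** * Limits for a vanishing sampling interval *)

Section small_step_limits.
Variable R : realType.
Local Notation mu := (@lebesgue_measure R).

Lemma cvg_expC0 (l : R[i]) :
  complex.Re (expC (l * D%:C%C)) @[D --> (0 : R)] --> (1 : R) /\
  complex.Im (expC (l * D%:C%C)) @[D --> (0 : R)] --> (0 : R).
Proof.
pose al := complex.Re l; pose be := complex.Im l.
have lRe D : complex.Re (l * D%:C%C) = al * D by rewrite complex_ReM /= mulr0 subr0.
have lIm D : complex.Im (l * D%:C%C) = be * D by rewrite complex_ImM /= mulr0 add0r.
have lin (c : R) : c * D @[D --> (0 : R)] --> (0 : R).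
  by rewrite -[X in _ --> X](mulr0 c); apply: cvgM; [exact: cvg_cst|exact: cvg_id].
have ce : expR (al * D) @[D --> (0 : R)] --> (1 : R).
  by rewrite -[X in _ --> X]expR0; apply: continuous_cvg (lin al); exact: continuous_expR.
have cc : cos (be * D) @[D --> (0 : R)] --> (1 : R).
  by rewrite -[X in _ --> X]cos0; apply: continuous_cvg (lin be); exact: continuous_cos.
have cs : sin (be * D) @[D --> (0 : R)] --> (0 : R).
  by rewrite -[X in _ --> X]sin0; apply: continuous_cvg (lin be); exact: continuous_sin.
split.
  rewrite (_ : (fun D => _) = (fun D => expR (al * D) * cos (be * D))).
    by rewrite -[X in _ --> X](mulr1 1); exact: cvgM.
  by apply/funext => D; rewrite /expC /= lRe lIm.
rewrite (_ : (fun D => _) = (fun D => expR (al * D) * sin (be * D))).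
  by rewrite -[X in _ --> X](mulr0 1); exact: cvgM.
by apply/funext => D; rewrite /expC /= lRe lIm.
Qed.

(** As D vanishes, the polynomial tends to (1 - X)^p for p the length of s. *)
Lemma cvg_lag_prod_coef (s : seq R[i]) (k : nat) :
  let Q D := \prod_(l <- s) (1 - expC (l * D%:C%C) *: 'X) in
  complex.Re (Q D)`_k @[D --> (0 : R)] --> ((-1) ^+ k * 'C(size s, k)%:R : R) /\
  complex.Im (Q D)`_k @[D --> (0 : R)] --> (0 : R).
Proof.
elim: s k => [|l s IH] k /=.
  rewrite (_ : (fun D => complex.Re _) = cst ((-1) ^+ k * 'C(0, k)%:R)); last first.
    apply/funext => D; rewrite big_nil coef1 bin0n.
    by case: k => [|k] /=; rewrite ?expr0 ?mul1r ?mulr0.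
  rewrite (_ : (fun D => complex.Im _) = cst 0); last first.
    by apply/funext => D; rewrite big_nil coef1; case: (_ == _).
  by split; exact: cvg_cst.
have [cR cI] := cvg_expC0 l.
pose z (D : R) := expC (l * D%:C%C).
pose Q (D : R) := \prod_(l <- s) (1 - expC (l * D%:C%C) *: 'X).
case: k => [|k].
  have [IR II] := IH 0%N.
  rewrite (_ : (fun D => complex.Re _) = (fun D => complex.Re (Q D)`_0)); last first.
    by apply/funext => D; rewrite big_cons coef_lag_factor mulr0 subr0.
  rewrite (_ : (fun D => complex.Im _) = (fun D => complex.Im (Q D)`_0)); last first.
    by apply/funext => D; rewrite big_cons coef_lag_factor mulr0 subr0.
  by move: IR; rewrite !bin0.
have [IR II] := IH k; have [JR JI] := IH k.+1.
split.
  rewrite (_ : (fun D => complex.Re _) = (fun D => complex.Re (Q D)`_k.+1 -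
      (complex.Re (z D) * complex.Re (Q D)`_k -
       complex.Im (z D) * complex.Im (Q D)`_k))).
    have -> : ((-1) ^+ k.+1 * 'C((size s).+1, k.+1)%:R : R) =
      (-1) ^+ k.+1 * 'C(size s, k.+1)%:R -
      (1 * ((-1) ^+ k * 'C(size s, k)%:R) - 0 * 0).
      by rewrite binS natrD exprS; ring.
    exact: (cvgB JR (cvgB (cvgM cR IR) (cvgM cI II))).
  apply/funext => D; rewrite big_cons coef_lag_factor -/(z D) -/(Q D).
  by rewrite -mulN1r complex_ReD complex_ReM complex_ReM complex_ImM /=; ring.
rewrite (_ : (fun D => complex.Im _) = (fun D => complex.Im (Q D)`_k.+1 -
    (complex.Re (z D) * complex.Im (Q D)`_k +
     complex.Im (z D) * complex.Re (Q D)`_k))).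
  rewrite [X in _ --> X]
    (_ : _ = 0 - (1 * 0 + 0 * ((-1) ^+ k * 'C(size s, k)%:R))).
    exact: (cvgB JI (cvgD (cvgM cR II) (cvgM cI IR))).
  by ring.
apply/funext => D; rewrite big_cons coef_lag_factor -/(z D) -/(Q D).
by rewrite -mulN1r complex_ImD complex_ImM complex_ReM complex_ImM /=; ring.
Qed.

Lemma continuous_bounded_ball (r : R -> R) (B : R) : continuous r ->
  exists C, forall y, `|y| <= B -> `|r y| <= C.
Proof.
move=> cr; have [B0|B0] := leP 0 B; last first.
  exists 0 => y yB.
  by move: (le_lt_trans (normr_ge0 y) (le_lt_trans yB B0)); rewrite ltxx.
have NB : - B <= B by lra.
have cn : {within `[- B, B], continuous (fun y => `|r y|)}.
  by apply: continuous_subspaceT => y; apply: cvg_norm; exact: cr.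
have [c _ cmax] := EVT_max NB cn.
by exists `|r c| => y yB; apply: cmax; rewrite in_itv/= -ler_norml.
Qed.

(** Dominated convergence: for |D| < 1 the arguments of r stay bounded. *)
Lemma cvg_Rintegral_scaled (w r : R -> R) (al be : R) :
  continuous w -> continuous r ->
  \int[mu]_(s in `[0, 1]) (w s * (r ((s + al) * D) * r ((s + be) * D)))
    @[D --> (0 : R)] --> r 0 ^+ 2 * \int[mu]_(s in `[0, 1]) w s.
Proof.
move=> cw cr.
pose f (D s : R) := w s * (r ((s + al) * D) * r ((s + be) * D)).
have int01 (h : R -> R) : continuous h -> mu.-integrable `[0, 1] (EFin \o h).
  by move=> ch; apply: continuous_compact_integrable;
    [exact: segment_compact|exact: continuous_subspaceT].
have cs D : continuous (f D).
  have cl (c : R) : continuous (fun s : R => r ((s + c) * D)).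
    have -> : (fun s => r ((s + c) * D)) = r \o (fun s => (s + c) * D) by [].
    move=> s; apply: continuous_comp; last exact: cr.
    by apply: cvgM; [apply: cvgD; [exact: cvg_id|exact: cvg_cst]|exact: cvg_cst].
  by move=> s; apply: cvgM; [exact: cw|apply: cvgM; exact: cl].
have cD s : continuous (f ^~ s).
  have cl (c : R) : continuous (fun D : R => r ((s + c) * D)).
    have -> : (fun D => r ((s + c) * D)) = r \o (fun D => (s + c) * D) by [].
    move=> D; apply: continuous_comp; last exact: cr.
    by apply: cvgM; [exact: cvg_cst|exact: cvg_id].
  by move=> D; apply: cvgM; [exact: cvg_cst|apply: cvgM; exact: cl].
have [W Wb] := continuous_bounded_ball 1 cw.
have [C1 C1b] := continuous_bounded_ball (1 + `|al|) cr.
have [C2 C2b] := continuous_bounded_ball (1 + `|be|) cr.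
have fb D : `]-1, 1[%classic D ->
    {ae mu, forall s, `[0, 1]%classic s -> `|f D s| <= W * (C1 * C2)}.
  move=> /= /[!in_itv]/= D1; apply: aeW => s /= /[!in_itv]/= /andP[s0 s1].
  have D1' : `|D| <= 1 by rewrite ler_norml; lra.
  have arg (c : R) : `|(s + c) * D| <= 1 + `|c|.
    rewrite normrM -[leRHS]mulr1 ler_pM//.
    by rewrite (le_trans (ler_normD _ _))// lerD2r ger0_norm.
  by rewrite normrM normrM !ler_pM ?mulr_ge0 ?Wb ?C1b ?C2b ?arg// ger0_norm.
have intc : mu.-integrable `[0, 1] (EFin \o (fun=> W * (C1 * C2))).
  by apply: int01 => s; exact: cvg_cst.
have c0 : {in (`]-1, 1[%classic : set R),
    continuous (fun D => \int[mu]_(s in `[0, 1]) f D s)}.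
  apply: (@continuity_under_integral _ _ _ mu f `[0, 1]%classic _ (-1) 1 _ _
    (fun=> W * (C1 * C2))) => //.
  - by move=> D _; exact: int01.
  - by apply: aeW => s _ D _; exact: cD.
have := c0 0; rewrite inE/= in_itv/= ltrN10 ltr01 => /(_ isT).
rewrite /f /continuous_at -RintegralZl//; last exact: int01.
rewrite (_ : \int[mu]_(s in _) (w s * (_ * _)) =
  \int[mu]_(s in `[0, 1]) (r 0 ^+ 2 * w s))//.
by apply: eq_Rintegral => s _; rewrite !mulr0 expr2 mulrC.
Qed.

End small_step_limits.

(** * The autocovariance at a fixed sampling interval *)

Section carma.
Variable R : realType.
Local Notation mu := (@lebesgue_measure R).

(** The recurrence of the moments turns into the differential equation with
    the roots lambda. The generating function being real, only the real parts
    of the coefficients matter. *)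
Lemma carma_lag_eq0 m (b : 'rV[R]_m) (A : 'M[R]_m) (e : 'cV[R]_m) p
    (lambda : 'I_p -> R[i]) (D t : R) :
  polyC_of (char_poly A) = \prod_(j < p) ('X - (lambda j)%:P) ->
  \sum_(0 <= k < p.+1) complex.Re (ar_poly lambda D)`_k *
    egf (moment b A e) (t - k%:R * D) = 0.
Proof.
move=> Alambda; set nu := moment b A e.
pose s := [seq lambda j | j <- enum 'I_p].
have As : polyC_of (char_poly A) = \prod_(l <- s) ('X - l%:P).
  by rewrite Alambda big_map big_enum.
have nub : cexp_bounded (fun k => (nu k)%:C%C).
  split; first exact: exp_bounded_moment.
  by exists 0, 0 => i; rewrite normr0 mul0r.
have := lagop_cegf_eq0 D nub (diffop_moment_eq0 b e As) t.
rewrite -ar_poly_seq /lagop.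
rewrite (sum_coef_widen (fun k => cegf _ (t - k%:R * D))
  (size_ar_poly lambda D)).
move=> /(congr1 (@complex.Re R)); rewrite complex_Re_sum /= => h.
rewrite -[RHS]h.
rewrite big_mkord; apply: eq_bigr => k _.
by rewrite complex_ReM /= egf_zero mulr0 subr0.
Qed.

Lemma Rintegral_sum_continuous (I : Type) (s : seq I) (c : I -> R)
    (f : I -> R -> R) :
  (forall i, continuous (f i)) ->
  \int[mu]_(x in `[0, 1]) (\sum_(i <- s) c i * f i x) =
  \sum_(i <- s) c i * \int[mu]_(x in `[0, 1]) f i x.
Proof.
move=> cf.
have int01 (h : R -> R) : continuous h -> mu.-integrable `[0, 1] (EFin \o h).
  by move=> ch; apply: continuous_compact_integrable;
    [exact: segment_compact|exact: continuous_subspaceT].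
have cs (s' : seq I) : continuous (fun x => \sum_(i <- s') c i * f i x).
  move=> x; apply: cvg_big => [|i _]; first exact: add_continuous.
  by apply: cvgM; [exact: cvg_cst|exact: cf].
elim: s => [|i s IH].
  rewrite big_nil; under eq_Rintegral do rewrite big_nil.
  by rewrite Rintegral_cst// mul0r.
rewrite big_cons -IH -RintegralZl//; last exact: int01.
rewrite -RintegralD//; first by apply: eq_Rintegral => x _; rewrite big_cons.
  by apply: int01 => x; apply: cvgM; [exact: cvg_cst|exact: cf].
exact: int01.
Qed.

Section kernel.
Variables (p : nat) (c : nat -> R) (g K : R -> R) (D : R).
Hypotheses (D0 : 0 < D) (K_continuous : continuous K).
Hypothesis gE : forall t, g t = if 0 < t then K t else 0.
(* F m is the kernel of the filtered process at time m; on the cell of index i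
   it is given by G (m + i), a continuous function. *)
Let F (m : int) (u : R) := \sum_(0 <= k < p.+1) c k * g ((m - k%:Z)%:~R * D - u).
Let G (m : nat) (x : R) := \sum_(0 <= k < m.+1) c k * K ((x + (m%:R - k%:R)) * D).

(** On this cell the term k of F m is inside the support of g exactly when
    k <= m + i. *)
Lemma sampled_kernel_cell (m i : nat) (s : R) : (m + i <= p)%N -> 0 < s <= 1 ->
  F m%:Z (- ((s + i%:R) * D)) = G (m + i) s.
Proof.
move=> mip /andP[s0 s1]; rewrite /F /G.
have mip' : ((m + i).+1 <= p.+1)%N by [].
rewrite (big_cat_nat _ mip')//= [X in _ + X]big1_seq ?addr0.
  apply: eq_big_nat => k /andP[_ km]; rewrite gE.
  have -> : (m%:Z - k%:Z)%:~R * D - - ((s + i%:R) * D) =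
     (s + ((m + i)%:R - k%:R)) * D :> R.
    by rewrite intrB -!pmulrn natrD; ring.
  rewrite ifT// mulr_gt0// ltr_pwDl// subr_ge0 ler_nat//.
move=> k /andP[_]; rewrite mem_index_iota => /andP[mk _].
rewrite gE ifF ?mulr0//; apply/negbTE; rewrite -leNgt.
have -> : (m%:Z - k%:Z)%:~R * D - - ((s + i%:R) * D) =
     - ((k%:R - (m + i).+1%:R + (1 - s)) * D) :> R.
  by rewrite intrB -!pmulrn -nat1r natrD; ring.
by rewrite oppr_le0 mulr_ge0 ?(ltW D0)// addr_ge0 ?subr_ge0 ?ler_nat.
Qed.

Lemma sampled_kernel_right (u : R) : 0 <= u -> F 0 u = 0.
Proof.
move=> u0; rewrite /F big1// => k _; rewrite gE ifF ?mulr0//.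
apply/negbTE; rewrite -leNgt sub0r intrN -pmulrn mulNr subr_le0.
by rewrite (le_trans _ u0)// oppr_le0 mulr_ge0// ltW.
Qed.

(** Far enough to the left all the terms of F n are inside the support of g,
    and the filter annihilates K. *)
Lemma sampled_kernel_left (n : nat) (u : R) : (n <= p)%N ->
  (forall t, \sum_(0 <= k < p.+1) c k * K (t - k%:R * D) = 0) ->
  u < - ((p - n)%:R * D) -> F n%:Z u = 0.
Proof.
move=> np ann up; rewrite -(ann (n%:R * D - u)).
apply: eq_big_nat => k /andP[_ kp]; rewrite gE ifT.
  by rewrite intrB -!pmulrn; congr (_ * K _); ring.
rewrite subr_gt0 (lt_le_trans up)// intrB -!pmulrn -mulNr ler_pM2r// natrB//.
rewrite opprB lerD2l lerN2 ler_nat//.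
Qed.

(** By the two lemmas above, only p - n cells contribute: F n vanishes to the
    left of them and F 0 to the right. *)
Lemma inner_sampled_kernel (n : nat) : (n <= p)%N ->
  (forall t, \sum_(0 <= k < p.+1) c k * K (t - k%:R * D) = 0) ->
  F n%:Z \in Lfun mu 2%:E -> F 0 \in Lfun mu 2%:E ->
  inner mu (F n%:Z) (F 0) = D * \sum_(0 <= i < p - n)
    \int[mu]_(s in `[0, 1]) (G (n + i) s * G i s).
Proof.
move=> np ann Fn2 F02.
have cG m : continuous (G m).
  have cK (z : R) : continuous (K \o (fun x => (x + z) * D)).
    move=> x; apply: continuous_comp; last exact: K_continuous.
    by apply: cvgM; [apply: cvgD; [exact: cvg_id|exact: cvg_cst]|exact: cvg_cst].
  move=> x; apply: cvg_big => [|k _]; first exact: add_continuous.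
  by apply: cvgM; [exact: cvg_cst|exact: cK].
rewrite /inner (Rintegral_cells D0 (M := p - n)); first last.
- by move=> u u0; rewrite sampled_kernel_right// mulr0.
- by move=> u up; rewrite sampled_kernel_left// mul0r.
- exact: Lfun2_mul_integrable.
rewrite mulr_sumr; apply: eq_big_nat => i /andP[_ ip].
apply: Rintegral_cell => // [x|s s01].
  by apply: cvgM; exact: cG.
rewrite sampled_kernel_cell//; last lia.
by rewrite -(@sampled_kernel_cell 0 i s)//; lia.
Qed.

End kernel.

End carma.

(** * Asymptotics of the integrals over the cells *)

Section small_step_integral.
Variable R : realType.
Local Notation mu := (@lebesgue_measure R).
Variables (N : nat) (K r : R -> R) (c : nat -> R -> R).
Hypotheses (r_continuous : continuous r) (KE : forall t, K t = t ^+ N * r t).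

Let G (m : nat) (D s : R) :=
  \sum_(0 <= k < m.+1) c k D * K ((s + (m%:R - k%:R)) * D).
Let w (m i k h : nat) (s : R) :=
  (s + (i%:R - h%:R)) ^+ N * (s + (m%:R - k%:R)) ^+ N.
Let J (m i k h : nat) (D : R) := \int[mu]_(s in `[0, 1])
  (w m i k h s * (r ((s + (i%:R - h%:R)) * D) * r ((s + (m%:R - k%:R)) * D))).

Let w_continuous m i k h : continuous (w m i k h).
Proof.
have cX (z : R) : continuous (fun s : R => (s + z) ^+ N).
  move=> s; apply: (@continuous_comp _ _ _ (fun s => s + z) (fun x => x ^+ N)).
    by apply: cvgD; [exact: cvg_id|exact: cvg_cst].
  exact: exprn_continuous.
by move=> s; apply: cvgM; exact: cX.
Qed.

(** Each factor K(x D) contributes a power D^N. *)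
Lemma small_step_integral m i D :
  \int[mu]_(s in `[0, 1]) (G m D s * G i D s) = D ^+ (2 * N) *
  \sum_(0 <= k < m.+1) \sum_(0 <= h < i.+1) c k D * (c h D * J m i k h D).
Proof.
have cr (z : R) : continuous (r \o (fun s => (s + z) * D)).
  move=> s; apply: continuous_comp; last exact: r_continuous.
  by apply: cvgM; [apply: cvgD; [exact: cvg_id|exact: cvg_cst]|exact: cvg_cst].
have cw k h : continuous (fun s => w m i k h s *
    (r ((s + (i%:R - h%:R)) * D) * r ((s + (m%:R - k%:R)) * D))).
  move=> s; apply: cvgM; first exact: w_continuous.
  by apply: cvgM; exact: cr.
under eq_Rintegral => s _.
  rewrite (_ : _ * _ = \sum_(k <- index_iota 0 m.+1) D ^+ (2 * N) * c k D *
    \sum_(h <- index_iota 0 i.+1) c h D * (w m i k h s *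
    (r ((s + (i%:R - h%:R)) * D) * r ((s + (m%:R - k%:R)) * D)))); last first.
    rewrite /G mulr_suml; apply: eq_bigr => k _.
    rewrite !mulr_sumr; apply: eq_bigr => h _.
    by rewrite /w !KE !exprMn mul2n -addnn exprD; ring.
  over.
rewrite Rintegral_sum_continuous; last first.
  move=> k s; apply: cvg_big => [|h _]; first exact: add_continuous.
  by apply: cvgM; [exact: cvg_cst|exact: cw].
rewrite mulr_sumr; apply: eq_bigr => k _; rewrite -mulrA; congr (_ * _).
by rewrite Rintegral_sum_continuous// mulr_sumr.
Qed.

Lemma cvg_small_step_integral p m i :
  (forall k, c k D @[D --> (0 : R)] --> ((-1) ^+ k * 'C(p, k)%:R : R)) ->
  \sum_(0 <= k < m.+1) \sum_(0 <= h < i.+1) c k D * (c h D * J m i k h D)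
    @[D --> (0 : R)] -->
  r 0 ^+ 2 * \sum_(0 <= k < m.+1) \sum_(0 <= h < i.+1)
    (-1) ^+ (h + k) * 'C(p, k)%:R * 'C(p, h)%:R *
    \int[mu]_(s in `[0, 1]) w m i k h s.
Proof.
move=> cc; rewrite mulr_sumr; apply: cvg_big => [|k _]; first exact: add_continuous.
rewrite mulr_sumr; apply: cvg_big => [|h _]; first exact: add_continuous.
rewrite [X in _ --> X](_ : _ = (-1) ^+ k * 'C(p, k)%:R * ((-1) ^+ h * 'C(p, h)%:R *
  (r 0 ^+ 2 * \int[mu]_(s in `[0, 1]) w m i k h s))).
  apply: cvgM; first exact: cc.
  apply: cvgM; first exact: cc.
  exact: cvg_Rintegral_scaled.
by rewrite exprD; ring.
Qed.

End small_step_integral.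

Section Csum.
Variable R : realType.

(** The cells are counted from 0 here, and from 1 in Csum. *)
Lemma CsumE (p q n : nat) : Csum R p q n =
  \sum_(0 <= i < p - n) \sum_(0 <= k < (n + i).+1) \sum_(0 <= h < i.+1)
    (-1) ^+ (h + k) * 'C(p, k)%:R * 'C(p, h)%:R *
    \int[@lebesgue_measure R]_(s in `[0, 1])
      ((s + (i%:R - h%:R)) ^+ (p - q - 1) *
       (s + ((n + i)%:R - k%:R)) ^+ (p - q - 1)).
Proof.
rewrite /Csum big_add1/=; apply: eq_bigr => i _; rewrite addnS.
apply: eq_bigr => k _; apply: eq_bigr => h _; congr (_ * _).
rewrite /Ccoef; apply: eq_Rintegral => s _; rewrite natrD -nat1r.
by congr (_ ^+ _ * _ ^+ _); ring.
Qed.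

End Csum.

Theorem theorem3p7 (R : realType) (d : measure_display) (T : measurableType d)
  (P : probability T R) (L : R -> {RV P >-> R}) (sigma : R)
  (L_levy : levy_process L) (L_second_order : second_order L)
  (L_mean : ('E_P[L 1%R])%E = 0%E)
  (L_var : ('E_P[fun w => (L 1 w ^+ 2)%R])%E = (sigma ^+ 2)%:E)
  (p q : nat) (q_lt_p : (q < p)%N)
  (a b : {poly R})
  (a_monic : a \is monic) (a_size : size a = p.+1)
  (b_size : (size b <= p)%N) (b_q : b`_q = 1)
  (b_gtq : forall j : nat, (q < j < p)%N -> b`_j = 0)
  (no_common_zero : forall z : R[i],
    ~ (root (polyC_of a) z /\ root (polyC_of b) z))
  (lambda : 'I_p -> R[i])
  (lambda_zeros : polyC_of a = \prod_(j < p) ('X - (lambda j)%:P))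
  (lambda_neg : forall j : 'I_p, complex.Re (lambda j) < 0)
  (Y : R -> {RV P >-> R}) (Y_carma : is_carma L a b Y)
  (n : nat) (n_range : (1 <= n <= p - 1)%N) :
  let gamma := gammaMA P (fun t => Y t) lambda n in
  let K := sigma ^+ 2 / ((p - q - 1)`!%:R ^+ 2) * Csum R p q n in
  (* where K vanishes the quotient in asymp_equiv is meaningless, and the
     asymptotic form is the limit below *)
  (K != 0 ->
    asymp_equiv gamma
      (fun D => sigma ^+ 2 * D ^+ (2 * (p - q) - 1)
                / ((p - q - 1)`!%:R ^+ 2) * Csum R p q n))
  /\ gamma D / D ^+ (2 * (p - q) - 1) @[D --> 0^'+] --> K.

Proof.
move=> gamma K.
have pE : (size a).-1 = p by rewrite a_size.
pose N := (p - q - 1)%N.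
have eE : (2 * (p - q) - 1 = (2 * N).+1)%N by rewrite /N; lia.
pose nu := carma_moment a b.
have gE t : carma_kernel a b t = if 0 < t then egf nu t else 0.
  exact: carma_kernelE.
have nub : exp_bounded nu by exact: exp_bounded_moment.
have nu0 i : (i < N)%N -> nu i = 0.
  move=> iN; apply: (@carma_moment_lt _ _ _ q); rewrite ?pE//.
  by move: iN; rewrite /N; lia.
have nuN : nu N = 1.
  by apply: (@carma_moment_eq _ _ _ q); rewrite ?pE// /N; lia.
(* the kernel is g(t) = t^N rho(t) for t > 0, with rho(0) = 1 / N! *)
have [rho [rhob rho0 rhoE]] := egf_factor nub nu0.
have Kc : continuous (egf nu) by exact: continuous_egf.
have rc : continuous (egf rho) by exact: continuous_egf.
have r0 : egf rho 0 = N`!%:R^-1 by rewrite egf_at0 rho0 nuN div1r.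
pose c k D := complex.Re (ar_poly lambda D)`_k.
have mg : measurable_fun setT (carma_kernel a b).
  rewrite (funext gE); apply: measurable_fun_if => //.
  - exact: measurable_fun_ltr.
  - by apply: measurable_funTS; exact: continuous_measurable_fun.
have gammaE D : 0 < D -> gamma D = sigma ^+ 2 * (D * \sum_(0 <= i < p - n)
    \int[@lebesgue_measure R]_(s in `[0, 1])
    ((\sum_(0 <= k < (n + i).+1)
        c k D * egf nu ((s + ((n + i)%:R - k%:R)) * D)) *
     (\sum_(0 <= k < i.+1) c k D * egf nu ((s + (i%:R - k%:R)) * D)))).
  move=> D0.
  have np : (n <= p)%N by lia.
  have ann t : \sum_(0 <= k < p.+1) c k D * egf nu (t - k%:R * D) = 0.
    by apply: carma_lag_eq0; rewrite companionmxK.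
  have [Fn2 F02 gF] := gammaMA_inner L_levy L_second_order L_mean L_var
    lambda n D mg Y_carma.
  rewrite /gamma gF; congr (_ * _).
  exact: (inner_sampled_kernel D0 Kc gE np ann Fn2 F02).
have lim : gamma D / D ^+ (2 * (p - q) - 1) @[D --> 0^'+] --> K.
  pose H D := sigma ^+ 2 * \sum_(0 <= i < p - n) \sum_(0 <= k < (n + i).+1)
    \sum_(0 <= h < i.+1) c k D * (c h D *
     \int[@lebesgue_measure R]_(s in `[0, 1])
      ((s + (i%:R - h%:R)) ^+ N * (s + ((n + i)%:R - k%:R)) ^+ N *
       (egf rho ((s + (i%:R - h%:R)) * D) *
        egf rho ((s + ((n + i)%:R - k%:R)) * D)))).
  have HE : {near 0^'+, H =1 (fun D => gamma D / D ^+ (2 * (p - q) - 1))}.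
    near=> D.
    have D0 : 0 < D by [].
    apply/esym.
    rewrite gammaE// /H eE -mulrA; congr (_ * _).
    under eq_bigr do rewrite (small_step_integral c rc rhoE).
    rewrite -mulr_sumr mulrA -exprS mulrAC divff ?mul1r//.
    by rewrite expf_neq0// gt_eqF.
  apply: (cvg_trans (near_eq_cvg HE)).
  apply: cvg_at_right_filter.
  rewrite /K CsumE -/N.
  set S := \sum_(0 <= i < p - n) _.
  have -> : sigma ^+ 2 / N`!%:R ^+ 2 * S = sigma ^+ 2 * (egf rho 0 ^+ 2 * S).
    by rewrite r0 exprVn mulrA.
  apply: cvgM; first exact: cvg_cst.
  rewrite /S mulr_sumr; apply: cvg_big => [|i _]; first exact: add_continuous.
  apply: (cvg_small_step_integral rc) => k.
  have [+ _] := cvg_lag_prod_coef [seq lambda j | j <- enum 'I_p] k.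
  rewrite size_map size_enum_ord /c.
  by under [in X in _ -> X]eq_fun do rewrite ar_poly_seq.
split=> // K0; rewrite /asymp_equiv.
rewrite (_ : (fun D => _) = (fun D => gamma D / D ^+ (2 * (p - q) - 1) / K)).
  by rewrite -[X in _ --> X](divff K0); apply: cvgM lim _; exact: cvg_cst.
apply/funext => D; rewrite -[RHS]mulrA -invfM.
by congr (_ / _); rewrite /K; ring.
Unshelve. all: by end_near. Qed.
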